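(* Let $n$ be an even positive integer, $\zeta_j=e^{(2j+1)\pi i/n}$ for $j=0,1,\ldots,n-1$, and let $x,y\in\mathbb{C}$ satisfy $x+\zeta_jy\notin\{0,-1,-2,\ldots\}$ for $j=0,1,\ldots,n-1$. Then, with infinite products over $m$ understood as zeta-regularized products, $$\prod_{m=0}^\infty\left((m+x)^n+y^n\right)^{(-1)^m}=\prod_{m=0}^{\infty}\left(\prod_{j=0}^{n-1}(m+x+\zeta_jy)^{(-1)^m}\right)=\frac{\left(\sqrt{\pi/2}\right)^n}{\prod_{j=0}^{n-1}\tilde\Gamma(x+\zeta_jy)}.$$
   Context: Complex powers use the principal branch. For a sequence $(a_m)_{m\ge0}$ of nonzero complex numbers, the zeta-regularized product $\prod_{m=0}^\infty a_m^{(-1)^m}$ is $\exp(-F'(0))$, where $F(s)=\sum_{m=0}^\infty(-1)^ma_m^{-s}$ for $\mathrm{Re}(s)>0$, analytically continued to a neighbourhood of $s=0$ (existence of the continuation being part of the assertion); when $a_m$ is written as a finite product $\prod_jb_{m,j}$, $a_m^{-s}$ is read as $\prod_jb_{m,j}^{-s}$. The modified gamma function is $$\tilde\Gamma(x)=\frac1x e^{x\log 2}\prod_{m=1}^\infty\left(e^{-x/m}\left(1+\frac xm\right)\right)^{(-1)^{m+1}},\qquad x\in\mathbb{C}\setminus\{0,-1,-2,\ldots\},$$ with this last infinite product an ordinary convergent product. *)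

(* Defs.v *)
From Stdlib Require Export Reals.
From Coquelicot Require Export Coquelicot.

Open Scope R_scope.

Definition Cexp (z : C) : C :=
  (exp (Re z) * cos (Im z), exp (Re z) * sin (Im z)).

(* The argument lies in (-PI, PI]: acos has values in [0, PI], and it is
   negated only when Im z < 0, where Re z / Cmod z lies strictly between
   -1 and 1. *)
Definition Carg (z : C) : R :=
  if Rle_dec 0 (Im z) then acos (Re z / Cmod z)
  else - acos (Re z / Cmod z).

Definition Clog (z : C) : C := (ln (Cmod z), Carg z).

(* Principal branch; only meaningful for z <> 0. *)
Definition Cpower (z s : C) : C := Cexp (s * Clog z)%C.

(* f 0 * ... * f (n - 1) *)
Fixpoint Cprod (f : nat -> C) (n : nat) : C :=
  match n with
  | O => RtoC 1
  | S k => (Cprod f k * f k)%C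
  end.

(* z ^ ((-1) ^ m) *)
Definition Calt (m : nat) (z : C) : C := if Nat.even m then z else (/ z)%C.

Definition is_Cprod_infinite (u : nat -> C) (l : C) : Prop :=
  filterlim (Cprod u) eventually (locally (T := C_UniformSpace) l).

Definition Cprod_infinite (u : nat -> C) : C :=
  iota (T := C_CompleteNormedModule) (is_Cprod_infinite u).

(* The product over m >= 1 is indexed by k = m - 1. *)
Definition mod_Gamma (x : C) : C :=
  (/ x * Cexp (x * RtoC (ln 2)) *
   Cprod_infinite (fun k : nat =>
     let m := S k in
     Calt (S m) (Cexp (- x / RtoC (INR m)) * (1 + x / RtoC (INR m)))))%C.

Definition holomorphic_at (F : C -> C) (s : C) : Prop :=
  ex_derive (K := C_AbsRing) (V := C_NormedModule) F s.

(* [pw m s] is the chosen reading of a_m^{-s}.  The function F is the sum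
   of the alternating series for Re s > 0, continued holomorphically to a
   disc around 0.  The union of that half-plane and the disc is open and
   connected, so by the identity theorem F'(0), and hence p, is determined
   by pw. *)
Definition is_alt_zeta_value (pw : nat -> C -> C) (p : C) : Prop :=
  exists (F : C -> C) (r : posreal),
    (forall s : C, 0 < Re s ->
       is_series (K := C_AbsRing) (V := C_NormedModule)
         (fun m : nat => (RtoC (-1) ^ m * pw m s)%C) (F s)) /\
    (forall s : C, 0 < Re s \/ Cmod s < r -> holomorphic_at F s) /\
    p = Cexp (- C_derive F (RtoC 0)).

(* p is the zeta-regularized product of a_m ^ ((-1) ^ m) over m >= 0. *)
Definition is_alt_zeta_prod (a : nat -> C) (p : C) : Prop :=
  (forall m : nat, a m <> RtoC 0) /\
  is_alt_zeta_value (fun m s => Cpower (a m) (- s)) p.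

(* The same for a_m written as b m 0 * ... * b m (k - 1), with a_m^{-s}
   read factor by factor. *)
Definition is_alt_zeta_prod_factored
    (k : nat) (b : nat -> nat -> C) (p : C) : Prop :=
  (forall m j : nat, (j < k)%nat -> b m j <> RtoC 0) /\
  is_alt_zeta_value (fun m s => Cprod (fun j => Cpower (b m j) (- s)) k) p.

Definition zeta_root (n j : nat) : C :=
  Cexp (RtoC ((2 * INR j + 1) * PI / INR n) * Ci)%C.

(* Main.v *)
Require Import Defs.
From Stdlib Require Import Psatz.

(** For a sequence [g], the mean of the sums of the first [2K] and of the first
    [2K + 1] terms of the series of general term [(-1) ^ m * g m] is
    [g 0 / 2 + (1 / 2) * sum_(k < K) (g (2k) - 2 g (2k+1) + g (2k+2))]
    ([alt_mean_even]): averaging turns an alternating series into a series of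
    second differences.  Take [g m = exp (- s * L m)], where [L m] is a logarithm
    of the [m]-th factor.  As [L m] behaves like [d * ln m], the second
    differences are [O (m ^ (-3/2))], locally uniformly in the half-plane
    [Re s >= - 1 / (4 d)] ([diff2_Lexp_bound]).  The means therefore converge
    there to a holomorphic function, which is the sum of the alternating series
    when [Re s > 0] ([alt_zeta_series]) and which may be differentiated term by
    term at [0] ([alt_zeta_derive]).  Hence the regularized product is [exp l],
    where [l] is the limit of the means of the sequence [L] itself
    ([loglike_zeta_value]).

    This description is additive in [L], so that regularization commutes with
    finite products.  Moreover, replacing finitely many [L m] by other logarithms
    of the same numbers leaves [exp l] unchanged.  Both products of the theorem are
    covered, with [L m] the sum of the principal logarithms of [m + x + zeta_j y],
    or the principal logarithm of [(m + x) ^ n + y ^ n]: the two are logarithms of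
    the same number because the [zeta_j] are the [n]-th roots of [-1]
    ([pow_add_factor]), and they coincide for large [m] because the arguments of
    the [n] factors tend to [0] ([Clog_Cprod_eventually]).

    What remains is one factor, [L m = Clog (m + x)] ([mod_Gamma_value]).  The
    product defining the modified gamma function converges, because the means
    attached to [x + 1] and to [1] do, and its factors [exp (- x / m)] contribute
    [exp (- x ln 2)], which cancels the prefactor.  Comparing [x] with [x + 1]
    supplies the factor [1 / x], and the value at [1] is Wallis' product, the source
    of [sqrt (PI / 2)]. *)

(** * Complex sequences, componentwise *)

(** Convergence in the product topology ([Clim_filterlim]), stated on the two
    components so that the calculus of real limits applies directly. *)
Definition Clim (u : nat -> C) (l : C) : Prop :=
  is_lim_seq (fun n => Re (u n)) (Re l) /\
  is_lim_seq (fun n => Im (u n)) (Im l).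

Lemma C_ext (z w : C) : Re z = Re w -> Im z = Im w -> z = w.
Proof. destruct z, w; simpl; intros -> ->; reflexivity. Qed.

Lemma Im_le_Cmod (z : C) : Rabs (Im z) <= Cmod z.
Proof. eapply Rle_trans; [apply Rmax_r | apply Rmax_Cmod]. Qed.

Lemma Cmod_le_abs (z : C) : Cmod z <= Rabs (Re z) + Rabs (Im z).
Proof.
  replace z with (RtoC (Re z) + Ci * RtoC (Im z))%C at 1
    by (apply C_ext; unfold Re, Im; simpl; ring).
  eapply Rle_trans; [apply Cmod_triangle|].
  rewrite Cmod_mult, Cmod_Ci, !Cmod_R; lra.
Qed.

Lemma Clim_filterlim (u : nat -> C) (l : C) :
  filterlim u eventually (locally (T := C_UniformSpace) l) <-> Clim u l.
Proof.
  split.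
  - intros H; split; intros P HP.
    + apply (H (fun z => P (Re z))). destruct HP as [e He]. exists e.
      intros z [Hz _]. now apply He.
    + apply (H (fun z => P (Im z))). destruct HP as [e He]. exists e.
      intros z [_ Hz]. now apply He.
  - intros [H1 H2] P [e He].
    assert (A1 : locally (Re l) (ball (Re l) e)) by (exists e; auto).
    assert (A2 : locally (Im l) (ball (Im l) e)) by (exists e; auto).
    apply H1 in A1; apply H2 in A2.
    destruct A1 as [N1 A1], A2 as [N2 A2].
    exists (max N1 N2). intros n Hn. apply He.
    split; [apply A1 | apply A2]; lia.
Qed.

Lemma Clim_Cmod (u : nat -> C) (l : C) :
  Clim u l <-> is_lim_seq (fun n => Cmod (u n - l)) 0.
Proof.
  split.
  - intros [H1 H2].
    apply is_lim_seq_le_le with (u := fun _ => 0)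
      (w := fun n => Rabs (Re (u n) - Re l) + Rabs (Im (u n) - Im l)).
    + intros n; split; [apply Cmod_ge_0|].
      apply (Cmod_le_abs (u n - l)).
    + apply is_lim_seq_const.
    + replace (Finite 0) with (Finite (Rabs (Re l - Re l) + Rabs (Im l - Im l)))
        by (f_equal; rewrite !Rminus_diag, Rabs_R0; lra).
      apply is_lim_seq_plus'; apply (is_lim_seq_abs _ (Finite _));
        apply is_lim_seq_minus'; auto using is_lim_seq_const.
  - intros H.
    assert (Aux : forall f : nat -> R, forall a : R,
      (forall n, Rabs (f n - a) <= Cmod (u n - l)) -> is_lim_seq f a).
    { intros f a Hf.
      apply is_lim_seq_ext with (fun n => (f n - a) + a); [intros; lra|].
      replace (Finite a) with (Finite (0 + a)) by (f_equal; lra).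
      apply is_lim_seq_plus'; [|apply is_lim_seq_const].
      apply is_lim_seq_abs_0.
      apply is_lim_seq_le_le with (u := fun _ => 0)
        (w := fun n => Cmod (u n - l)); auto using is_lim_seq_const.
      intros n; split; [apply Rabs_pos | apply Hf]. }
    split; apply Aux; intros n.
    + apply (re_le_Cmod (u n - l)).
    + apply (Im_le_Cmod (u n - l)).
Qed.

Lemma Clim_unique (u : nat -> C) (l1 l2 : C) :
  Clim u l1 -> Clim u l2 -> l1 = l2.
Proof.
  intros [A1 A2] [B1 B2].
  apply is_lim_seq_unique in A1, A2, B1, B2.
  apply C_ext; congruence.
Qed.

Lemma Clim_ext_loc (u v : nat -> C) (l : C) :
  eventually (fun n => u n = v n) -> Clim u l -> Clim v l.
Proof.
  intros [N H] [A1 A2]; split.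
  - eapply is_lim_seq_ext_loc; [|apply A1]. exists N; intros; now rewrite H.
  - eapply is_lim_seq_ext_loc; [|apply A2]. exists N; intros; now rewrite H.
Qed.

Lemma Clim_ext (u v : nat -> C) (l : C) :
  (forall n, u n = v n) -> Clim u l -> Clim v l.
Proof. intros H; apply Clim_ext_loc; exists 0%nat; auto. Qed.

Lemma Clim_const (l : C) : Clim (fun _ => l) l.
Proof. split; apply is_lim_seq_const. Qed.

Lemma Clim_plus (u v : nat -> C) (a b : C) :
  Clim u a -> Clim v b -> Clim (fun n => u n + v n)%C (a + b)%C.
Proof.
  intros [A1 A2] [B1 B2]; split; simpl; now apply is_lim_seq_plus'.
Qed.

Lemma Clim_mult (u v : nat -> C) (a b : C) :
  Clim u a -> Clim v b -> Clim (fun n => u n * v n)%C (a * b)%C.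
Proof.
  intros [A1 A2] [B1 B2]; split; simpl.
  - apply is_lim_seq_minus'; now apply is_lim_seq_mult'.
  - apply is_lim_seq_plus'; now apply is_lim_seq_mult'.
Qed.

Lemma Clim_scal (c : C) (u : nat -> C) (a : C) :
  Clim u a -> Clim (fun n => c * u n)%C (c * a)%C.
Proof. apply Clim_mult, Clim_const. Qed.

Lemma Clim_minus (u v : nat -> C) (a b : C) :
  Clim u a -> Clim v b -> Clim (fun n => u n - v n)%C (a - b)%C.
Proof.
  intros A B; apply Clim_plus; auto.
  apply Clim_ext with (fun n => -(1) * v n)%C; [intros; ring|].
  replace (- b)%C with (-(1) * b)%C by ring. now apply Clim_scal.
Qed.

Lemma Clim_RtoC (u : nat -> R) (l : R) :
  is_lim_seq u l -> Clim (fun n => RtoC (u n)) (RtoC l).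
Proof. split; simpl; auto using is_lim_seq_const. Qed.

Lemma Clim_bound_0 (u : nat -> C) (v : nat -> R) :
  (forall n, Cmod (u n) <= v n) -> is_lim_seq v 0 -> Clim u (RtoC 0).
Proof.
  intros H Hv. apply Clim_Cmod.
  apply is_lim_seq_le_le with (u := fun _ => 0) (w := v);
    auto using is_lim_seq_const.
  intros n. replace (u n - RtoC 0)%C with (u n) by ring.
  split; [apply Cmod_ge_0 | apply H].
Qed.

Lemma Clim_subseq (u : nat -> C) (l : C) (phi : nat -> nat) :
  (forall n, (n <= phi n)%nat) -> Clim u l -> Clim (fun n => u (phi n)) l.
Proof.
  intros H [A1 A2].
  assert (F : filterlim phi eventually eventually).
  { intros P [N HN]. exists N. intros n Hn. apply HN. specialize (H n). lia. }
  split; [exact (is_lim_seq_subseq _ _ phi F A1) | exact (is_lim_seq_subseq _ _ phi F A2)].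
Qed.

(** Reduces the convergence of alternating sums to that of sums of consecutive
    terms grouped in pairs. *)
Lemma Clim_of_even_odd (u : nat -> C) (l : C) :
  Clim (fun k => u (2 * k)%nat) l ->
  Clim (fun m => u (S m) - u m)%C (RtoC 0) -> Clim u l.
Proof.
  intros He Hd.
  assert (Ho : Clim (fun k => u (S (2 * k))) l).
  { apply Clim_ext with (fun k => u (2 * k)%nat + (u (S (2 * k)) - u (2 * k)%nat))%C.
    - intros; ring.
    - replace l with (l + RtoC 0)%C by ring. apply Clim_plus; auto.
      apply (Clim_subseq _ _ (fun k => 2 * k)%nat) in Hd; auto. intros; lia. }
  assert (Aux : forall (f : nat -> R) (a : R), is_lim_seq (fun k => f (2 * k)%nat) a ->
    is_lim_seq (fun k => f (S (2 * k))) a -> is_lim_seq f a).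
  { intros f a A B P HP. destruct (A P HP) as [N1 H1], (B P HP) as [N2 H2].
    exists (2 * (N1 + N2) + 1)%nat. intros n Hn.
    destruct (Nat.Even_or_Odd n) as [[k ->]|[k ->]].
    - apply H1; lia.
    - replace (2 * k + 1)%nat with (S (2 * k)) by lia. apply H2; lia. }
  destruct He, Ho; split; apply Aux; auto.
Qed.

Lemma inv_INR_lim : is_lim_seq (fun m => / (INR m + 1)) 0.
Proof.
  change (Finite 0) with (Rbar_inv p_infty). apply is_lim_seq_inv; [|discriminate].
  eapply is_lim_seq_plus; [apply is_lim_seq_INR | apply is_lim_seq_const | reflexivity].
Qed.

Lemma RtoC_m1 : RtoC (-1) = (- RtoC 1)%C.
Proof. apply C_ext; unfold Re, Im; simpl; ring. Qed.

(** * The complex exponential *)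

Lemma Cexp_plus (a b : C) : Cexp (a + b) = (Cexp a * Cexp b)%C.
Proof.
  unfold Cexp. apply C_ext; unfold Re, Im; simpl; rewrite exp_plus, ?cos_plus, ?sin_plus; ring.
Qed.

Lemma Cexp_0 : Cexp (RtoC 0) = RtoC 1.
Proof. unfold Cexp; apply C_ext; unfold Re, Im; simpl; rewrite exp_0, ?cos_0, ?sin_0; ring. Qed.

Lemma Cexp_neq_0 (z : C) : Cexp z <> RtoC 0.
Proof.
  intros H. assert (E : (Cexp z * Cexp (- z))%C = RtoC 1).
  { rewrite <- Cexp_plus, <- Cexp_0. f_equal. ring. }
  rewrite H, Cmult_0_l in E. apply (f_equal fst) in E; simpl in E; lra.
Qed.

Lemma Cexp_opp (z : C) : Cexp (- z) = (/ Cexp z)%C.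
Proof.
  assert (E : (Cexp z * Cexp (- z))%C = RtoC 1).
  { rewrite <- Cexp_plus, <- Cexp_0. f_equal. ring. }
  pose proof (Cexp_neq_0 z) as H.
  rewrite <- (Cmult_1_r (/ Cexp z)), <- E. field. exact H.
Qed.

Lemma Cexp_RtoC (r : R) : Cexp (RtoC r) = RtoC (exp r).
Proof. unfold Cexp; apply C_ext; unfold Re, Im; simpl; rewrite ?cos_0, ?sin_0; ring. Qed.

Lemma Cmod_Cexp (z : C) : Cmod (Cexp z) = exp (Re z).
Proof.
  unfold Cexp, Cmod; simpl.
  replace (_ + _) with ((exp (Re z))²).
  - apply sqrt_Rsqr, Rlt_le, exp_pos.
  - unfold Rsqr. pose proof (sin2_cos2 (Im z)) as H. unfold Rsqr in H.
    transitivity (exp (Re z) * exp (Re z) *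
      (sin (Im z) * sin (Im z) + cos (Im z) * cos (Im z))); [rewrite H|]; ring.
Qed.

Lemma Cmod_Cexp_le (z : C) : Cmod (Cexp z) <= exp (Cmod z).
Proof.
  rewrite Cmod_Cexp. pose proof (re_le_Cmod z) as H.
  pose proof (Rle_abs (Re z)).
  destruct (Req_dec (Re z) (Cmod z)) as [->|]; [lra|].
  apply Rlt_le, exp_increasing. lra.
Qed.

Lemma Clim_Cexp (u : nat -> C) (l : C) :
  Clim u l -> Clim (fun n => Cexp (u n)) (Cexp l).
Proof.
  intros [A B].
  assert (E : is_lim_seq (fun n => exp (Re (u n))) (exp (Re l))).
  { apply is_lim_seq_continuous; auto. apply derivable_continuous_pt, derivable_pt_exp. }
  assert (Co : is_lim_seq (fun n => cos (Im (u n))) (cos (Im l))).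
  { apply is_lim_seq_continuous; auto. apply continuity_cos. }
  assert (Si : is_lim_seq (fun n => sin (Im (u n))) (sin (Im l))).
  { apply is_lim_seq_continuous; auto. apply continuity_sin. }
  split; simpl; now apply is_lim_seq_mult'.
Qed.

(** * Taylor bounds along real paths in the complex plane *)

(** Mean value bounds are only needed along real segments of the complex plane,
    where a derivative is a pair of real derivatives. *)
Definition path_derive (f : R -> C) (t : R) (l : C) : Prop :=
  is_derive (fun t => Re (f t)) t (Re l) /\
  is_derive (fun t => Im (f t)) t (Im l).

Lemma path_derive_plus (f g : R -> C) (t : R) (a b : C) :
  path_derive f t a -> path_derive g t b ->
  path_derive (fun t => f t + g t)%C t (a + b)%C.
Proof.
  intros [A1 A2] [B1 B2]; split; simpl.
  - exact (is_derive_plus _ _ _ _ _ A1 B1).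
  - exact (is_derive_plus _ _ _ _ _ A2 B2).
Qed.

Lemma path_derive_scal (c : C) (f : R -> C) (t : R) (a : C) :
  path_derive f t a -> path_derive (fun t => c * f t)%C t (c * a)%C.
Proof.
  intros [A1 A2]; split; simpl.
  - apply (is_derive_minus (V := R_NormedModule)); now apply is_derive_scal.
  - apply (is_derive_plus (V := R_NormedModule)); now apply is_derive_scal.
Qed.

Lemma path_derive_Cexp (a b : C) (t : R) :
  path_derive (fun t => Cexp (a + RtoC t * b)) t (b * Cexp (a + RtoC t * b)).
Proof.
  split; unfold Re, Im; simpl; auto_derive; auto; unfold Re, Im; simpl;
    unfold Rminus; ring.
Qed.

Lemma path_derive_const (a : C) (t : R) : path_derive (fun _ => a) t (RtoC 0).
Proof. split; unfold Re, Im; simpl; auto_derive; auto. Qed.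

(** The real mean value inequality is applied to the two components, which costs
    the factor [2]. *)
Lemma path_taylor1 (f df : R -> C) (D : R) :
  (forall t, Rabs t <= 1 -> path_derive f t (df t) /\ Cmod (df t) <= D) ->
  forall t, Rabs t <= 1 -> Cmod (f t - f 0)%C <= 2 * D.
Proof.
  intros H t Ht.
  assert (HD : 0 <= D).
  { destruct (H 0) as [_ H0]; [rewrite Rabs_R0; lra|].
    pose proof (Cmod_ge_0 (df 0)); lra. }
  assert (HtD : D * Rabs (t - 0) <= D).
  { rewrite Rminus_0_r. pose proof (Rabs_pos t). nra. }
  eapply Rle_trans; [apply Cmod_le_abs|].
  assert (A : Rabs (Re (f t) - Re (f 0)) <= D * Rabs (t - 0)).
  { apply bounded_variation with (h := fun t => Re (f t)) (dh := fun t => Re (df t)).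
    intros s Hs. rewrite !Rminus_0_r in Hs.
    destruct (H s) as [[H1 _] H2]; [lra|]. split; auto.
    eapply Rle_trans; [apply re_le_Cmod | apply H2]. }
  assert (B : Rabs (Im (f t) - Im (f 0)) <= D * Rabs (t - 0)).
  { apply bounded_variation with (h := fun t => Im (f t)) (dh := fun t => Im (df t)).
    intros s Hs. rewrite !Rminus_0_r in Hs.
    destruct (H s) as [[_ H1] H2]; [lra|]. split; auto.
    eapply Rle_trans; [apply Im_le_Cmod | apply H2]. }
  change (Re (f t - f 0)%C) with (Re (f t) - Re (f 0)).
  change (Im (f t - f 0)%C) with (Im (f t) - Im (f 0)).
  lra.
Qed.

Lemma path_taylor2 (f df ddf : R -> C) (M : R) :
  (forall t, Rabs t <= 1 -> path_derive f t (df t)) ->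
  (forall t, Rabs t <= 1 -> path_derive df t (ddf t) /\ Cmod (ddf t) <= M) ->
  Cmod (f 1 - f 0 - df 0)%C <= 4 * M.
Proof.
  intros H1 H2.
  replace (f 1 - f 0 - df 0)%C with
    ((f 1 + - RtoC 1 * df 0) - (f 0 + - RtoC 0 * df 0))%C by ring.
  replace (4 * M) with (2 * (2 * M)) by ring.
  apply (path_taylor1 (fun t => f t + - RtoC t * df 0)%C
           (fun t => df t - df 0)%C); [|rewrite Rabs_R1; lra].
  intros t Ht. split.
  - apply path_derive_plus; auto.
    split; unfold Re, Im; simpl; auto_derive; auto; ring.
  - exact (path_taylor1 df ddf M H2 t Ht).
Qed.

Lemma Cmod_RtoC_mult_le (t : R) (z : C) :
  Rabs t <= 1 -> Cmod (RtoC 0 + RtoC t * z) <= Cmod z.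
Proof.
  intros Ht. rewrite Cplus_0_l, Cmod_mult, Cmod_R.
  pose proof (Cmod_ge_0 z). nra.
Qed.

Lemma exp_le (a b : R) : a <= b -> exp a <= exp b.
Proof. intros [H| ->]; [left; now apply exp_increasing | lra]. Qed.

Lemma Cexp_taylor1 (z : C) :
  Cmod (Cexp z - RtoC 1) <= 2 * (Cmod z * exp (Cmod z)).
Proof.
  replace (Cexp z - RtoC 1)%C with
    (Cexp (RtoC 0 + RtoC 1 * z) - Cexp (RtoC 0 + RtoC 0 * z))%C.
  2:{ replace (RtoC 0 + RtoC 1 * z)%C with z by ring.
      replace (RtoC 0 + RtoC 0 * z)%C with (RtoC 0) by ring.
      now rewrite Cexp_0. }
  apply (path_taylor1 (fun t => Cexp (RtoC 0 + RtoC t * z))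
     (fun t => z * Cexp (RtoC 0 + RtoC t * z))%C); [|rewrite Rabs_R1; lra].
  intros t Ht; split; [apply path_derive_Cexp|].
  rewrite Cmod_mult. apply Rmult_le_compat_l; [apply Cmod_ge_0|].
  eapply Rle_trans; [apply Cmod_Cexp_le|].
  now apply exp_le, Cmod_RtoC_mult_le.
Qed.

Lemma Cexp_taylor2 (z : C) :
  Cmod (Cexp z - RtoC 1 - z) <= 4 * ((Cmod z) ^ 2 * exp (Cmod z)).
Proof.
  replace (Cexp z - RtoC 1 - z)%C with
    (Cexp (RtoC 0 + RtoC 1 * z) - Cexp (RtoC 0 + RtoC 0 * z)
      - z * Cexp (RtoC 0 + RtoC 0 * z))%C.
  2:{ replace (RtoC 0 + RtoC 1 * z)%C with z by ring.
      replace (RtoC 0 + RtoC 0 * z)%C with (RtoC 0) by ring.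
      rewrite Cexp_0. ring. }
  apply (path_taylor2 (fun t => Cexp (RtoC 0 + RtoC t * z))
     (fun t => z * Cexp (RtoC 0 + RtoC t * z))%C
     (fun t => z * (z * Cexp (RtoC 0 + RtoC t * z)))%C).
  - intros t Ht; apply path_derive_Cexp.
  - intros t Ht; split; [apply path_derive_scal, path_derive_Cexp|].
    rewrite !Cmod_mult. simpl. rewrite Rmult_1_r, Rmult_assoc.
    repeat (apply Rmult_le_compat_l; [apply Cmod_ge_0|]).
    eapply Rle_trans; [apply Cmod_Cexp_le|].
    now apply exp_le, Cmod_RtoC_mult_le.
Qed.

(** * Dominated series and derivatives of limits *)

Fixpoint csum (f : nat -> C) (n : nat) : C :=
  match n with
  | O => RtoC 0
  | S k => (csum f k + f k)%C
  end.

Lemma sum_n_csum (f : nat -> C) (n : nat) :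
  sum_n (G := C_AbelianMonoid) f n = csum f (S n).
Proof.
  induction n as [|n IH].
  - rewrite sum_O. simpl. now rewrite Cplus_0_l.
  - rewrite sum_Sn, IH. reflexivity.
Qed.

Lemma csum_ext (f g : nat -> C) (n : nat) :
  (forall k, (k < n)%nat -> f k = g k) -> csum f n = csum g n.
Proof.
  induction n as [|n IH]; intros H; simpl; auto.
  rewrite IH, H; auto.
Qed.

Lemma csum_plus (f g : nat -> C) (n : nat) :
  csum (fun k => f k + g k)%C n = (csum f n + csum g n)%C.
Proof. induction n as [|n IH]; simpl; [ring | rewrite IH; ring]. Qed.

Lemma csum_scal (c : C) (f : nat -> C) (n : nat) :
  csum (fun k => c * f k)%C n = (c * csum f n)%C.
Proof. induction n as [|n IH]; simpl; [ring | rewrite IH; ring]. Qed.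

Lemma Clim_S (u : nat -> C) (l : C) : Clim (fun n => u (S n)) l <-> Clim u l.
Proof.
  unfold Clim. rewrite (is_lim_seq_incr_1 (fun n => Re (u n))),
    (is_lim_seq_incr_1 (fun n => Im (u n))). reflexivity.
Qed.

Lemma is_series_Clim (a : nat -> C) (l : C) :
  is_series (K := C_AbsRing) (V := C_NormedModule) a l <-> Clim (csum a) l.
Proof.
  rewrite <- Clim_S, <- Clim_filterlim.
  split; intros H; eapply filterlim_ext; try exact H; intros n; cbv beta;
    [|symmetry]; apply (sum_n_csum a n).
Qed.

(** The majorant [(k + 1) ^ (- 3 / 2)]: the second differences to be summed are
    [O (m ^ (-2))] at [s = 0] up to logarithms, and the half power given away leaves
    room for [Re s] slightly negative. *)
Definition w32 (k : nat) : R := / ((INR k + 1) * sqrt (INR k + 1)).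

Lemma w32_pos (k : nat) : 0 < w32 k.
Proof.
  pose proof (pos_INR k). apply Rinv_0_lt_compat, Rmult_lt_0_compat; [lra|].
  apply sqrt_lt_R0; lra.
Qed.

(** The comparison of [x ^ (- 3 / 2)] with its primitive [- 2 / sqrt x], in
    telescoping form. *)
Lemma w32_telescope (k : nat) :
  w32 (S k) <= 2 / sqrt (INR k + 1) - 2 / sqrt (INR k + 2).
Proof.
  unfold w32. rewrite S_INR. pose proof (pos_INR k) as Hk.
  replace (INR k + 1 + 1) with (INR k + 2) by ring.
  set (a := sqrt (INR k + 1)). set (b := sqrt (INR k + 2)).
  assert (Ha : 0 < a) by (apply sqrt_lt_R0; lra).
  assert (Hab : a < b) by (apply sqrt_lt_1; lra).
  assert (Ea : a * a = INR k + 1) by (apply sqrt_sqrt; lra).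
  assert (Eb : b * b = INR k + 2) by (apply sqrt_sqrt; lra).
  rewrite <- Eb.
  replace (2 / a - 2 / b) with (2 / (a * b * (a + b))).
  2:{ replace (2 / (a * b * (a + b))) with (2 * (b * b - a * a) / (a * b * (a + b)))
        by (rewrite Ea, Eb; f_equal; ring).
      field. repeat split; lra. }
  replace (/ (b * b * b)) with (2 / (2 * (b * b * b))) by (field; lra).
  apply Rmult_le_compat_l; [lra|]. apply Rinv_le_contravar.
  - repeat apply Rmult_lt_0_compat; lra.
  - assert (a * b * (a + b) <= b * b * (b + b)).
    { apply Rmult_le_compat; nra. }
    lra.
Qed.

Lemma sum_w32_le (n : nat) : sum_n w32 n <= 3.
Proof.
  assert (H : sum_n w32 n <= 3 - 2 / sqrt (INR n + 1)).
  { induction n as [|n IH].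
    - rewrite sum_O. unfold w32. simpl. rewrite Rplus_0_l, sqrt_1. lra.
    - rewrite sum_Sn.
      change (sum_n w32 n + w32 (S n) <= 3 - 2 / sqrt (INR (S n) + 1)).
      pose proof (w32_telescope n) as T.
      rewrite (S_INR n).
      replace (INR n + 1 + 1) with (INR n + 2) by ring. lra. }
  assert (0 < 2 / sqrt (INR n + 1)); [|lra].
  pose proof (pos_INR n). apply Rdiv_lt_0_compat; [lra|].
  apply sqrt_lt_R0; lra.
Qed.

Lemma ex_series_w32 : ex_series w32.
Proof.
  destruct (ex_finite_lim_seq_incr (sum_n w32) 3) as [l Hl].
  - intros n. rewrite sum_Sn. unfold plus; simpl. pose proof (w32_pos (S n)). lra.
  - apply sum_w32_le.
  - exists l. exact Hl.
Qed.

Lemma dominated_csum_le (a : nat -> C) (K : R) (n : nat) :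
  0 <= K -> (forall k, Cmod (a k) <= K * w32 k) -> Cmod (csum a n) <= 3 * K.
Proof.
  intros HK H. destruct n as [|n].
  - simpl. rewrite Cmod_0. lra.
  - assert (A : Cmod (csum a (S n)) <= K * sum_n w32 n).
    { induction n as [|n IH].
      - rewrite sum_O. simpl. rewrite Cplus_0_l. apply H.
      - rewrite sum_Sn. unfold plus; simpl in *.
        eapply Rle_trans; [apply Cmod_triangle|].
        specialize (H (S n)). lra. }
    pose proof (sum_w32_le n). nra.
Qed.

Lemma Clim_Cmod_le (u : nat -> C) (l : C) (B : R) :
  Clim u l -> (forall n, Cmod (u n) <= B) -> Cmod l <= B.
Proof.
  intros Hu HB. apply Clim_Cmod in Hu.
  assert (A : Rbar_le (Cmod l - B) 0); [|simpl in A; lra].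
  apply is_lim_seq_le with (u := fun _ => Cmod l - B)
    (v := fun n => Cmod (u n - l)); auto using is_lim_seq_const.
  intros n. specialize (HB n).
  pose proof (Cmod_triangle (u n) (- (u n - l))) as T.
  replace (u n + - (u n - l))%C with l in T by ring.
  rewrite Cmod_opp in T. lra.
Qed.

Lemma dominated_csum_cv (a : nat -> C) (K : R) :
  (forall k, Cmod (a k) <= K * w32 k) -> exists l, Clim (csum a) l.
Proof.
  intros H.
  destruct (ex_series_le (V := C_CompleteNormedModule) a (fun k => K * w32 k))
    as [l Hl].
  - intros k. exact (H k).
  - apply (ex_series_scal (V := R_NormedModule)), ex_series_w32.
  - exists l. apply is_series_Clim. exact Hl.
Qed.

(** A remainder of second order is the form in which derivatives are obtained
    here, since it survives limits. *)
Lemma is_derive_of_quadratic (f : C -> C) (s0 l : C) (delta M : R) :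
  0 < delta -> 0 <= M ->
  (forall s, Cmod (s - s0) < delta ->
     Cmod (f s - f s0 - (s - s0) * l) <= M * Cmod (s - s0) ^ 2) ->
  is_derive (K := C_AbsRing) (V := C_NormedModule) f s0 l.
Proof.
  intros Hd HM H. split; [apply is_linear_scal_l|].
  intros x Hx.
  assert (E : x = s0).
  { symmetry. apply (is_filter_lim_locally_unique (K := C_AbsRing)
      (V := AbsRing_NormedModule C_AbsRing)). exact Hx. }
  rewrite E; clear x Hx E. intros eps.
  assert (Hp : 0 < Rmin delta (eps / (M + 1))).
  { apply Rmin_pos; auto. apply Rdiv_lt_0_compat; [apply cond_pos | lra]. }
  exists (mkposreal _ Hp). intros s Hs.
  change (Cmod (s - s0) < Rmin delta (eps / (M + 1))) in Hs.
  change (Cmod (f s - f s0 - (s - s0) * l) <= eps * Cmod (s - s0)).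
  eapply Rle_trans; [apply H; eapply Rlt_le_trans; [exact Hs | apply Rmin_l]|].
  pose proof (Rmin_r delta (eps / (M + 1))) as H2.
  pose proof (Cmod_ge_0 (s - s0)) as H3.
  assert (H4 : (M + 1) * Cmod (s - s0) <= eps).
  { replace (pos eps) with ((M + 1) * (eps / (M + 1))) by (field; lra).
    apply Rmult_le_compat_l; lra. }
  simpl. rewrite Rmult_1_r. nra.
Qed.

(** Uniform quadratic remainders stand in for the locally uniform bounds on second
    derivatives that Cauchy's formula would provide. *)
Lemma limit_derive (u : nat -> C -> C) (du : nat -> C) (H : C -> C) (dH s0 : C)
    (delta M : R) :
  0 < delta -> 0 <= M ->
  (forall k s, Cmod (s - s0) < delta ->
     Cmod (u k s - u k s0 - (s - s0) * du k) <= M * Cmod (s - s0) ^ 2) ->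
  (forall s, Cmod (s - s0) < delta -> Clim (fun k => u k s) (H s)) ->
  Clim du dH ->
  is_derive (K := C_AbsRing) (V := C_NormedModule) H s0 dH.
Proof.
  intros Hd HM Hr HH HdH.
  apply is_derive_of_quadratic with delta M; auto.
  intros s Hs.
  apply Clim_Cmod_le with (fun k => u k s - u k s0 - (s - s0) * du k)%C; auto.
  apply Clim_minus; [|now apply Clim_scal].
  apply Clim_minus; auto.
  apply HH. replace (s0 - s0)%C with (RtoC 0) by ring. now rewrite Cmod_0.
Qed.

(** * Means of consecutive partial sums of an alternating series *)

(** The mean of the sums of the first [M] and of the first [M + 1] terms of the
    alternating series: the first step of Euler's transformation.  It converges for
    sequences, such as logarithms, whose alternating series diverges. *)
Definition alt_mean (g : nat -> C) (M : nat) : C :=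
  (csum (fun m => RtoC (-1) ^ m * g m) M + RtoC (-1) ^ M * g M / RtoC 2)%C.

Definition diff2 (g : nat -> C) (m : nat) : C :=
  (g m - RtoC 2 * g (S m) + g (S (S m)))%C.

Lemma Cpow_m1_even (k : nat) : (RtoC (-1) ^ (2 * k))%C = RtoC 1.
Proof.
  rewrite Cpow_mult_r. replace (RtoC (-1) ^ 2)%C with (RtoC 1).
  - apply Cpow_1_l.
  - apply C_ext; unfold Re, Im; simpl; ring.
Qed.

Lemma Cmod_pow_m1 (m : nat) : Cmod (RtoC (-1) ^ m) = 1.
Proof.
  rewrite Cmod_pow, Cmod_R. replace (Rabs (-1)) with 1.
  - apply pow1.
  - rewrite Rabs_left; lra.
Qed.

Lemma RtoC_neq (a : R) : a <> 0 -> RtoC a <> RtoC 0.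
Proof. intros H E. apply H. now apply RtoC_inj in E. Qed.

Lemma alt_mean_even (g : nat -> C) (K : nat) :
  alt_mean g (2 * K) =
  (g O / RtoC 2 + csum (fun k => diff2 g (2 * k)) K / RtoC 2)%C.
Proof.
  induction K as [|K IH].
  - unfold alt_mean. simpl. field.
  - replace (2 * S K)%nat with (S (S (2 * K))) by lia.
    cut (alt_mean g (S (S (2 * K))) = alt_mean g (2 * K) + diff2 g (2 * K) / RtoC 2)%C.
    { intros E. rewrite E, IH. simpl. field. }
    unfold alt_mean, diff2. cbn [csum].
    rewrite (Cpow_S _ (S (2 * K))), (Cpow_S _ (2 * K)), Cpow_m1_even.
    rewrite RtoC_m1.
    field.
Qed.

Lemma alt_mean_step (g : nat -> C) (M : nat) :
  (alt_mean g (S M) - alt_mean g M)%C =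
  (RtoC (-1) ^ M * (g M - g (S M)) / RtoC 2)%C.
Proof.
  unfold alt_mean. cbn [csum]. rewrite Cpow_S.
  rewrite RtoC_m1.
  field.
Qed.

Lemma alt_mean_Clim (g : nat -> C) (l : C) :
  Clim (fun M => g M - g (S M))%C (RtoC 0) ->
  Clim (fun K => alt_mean g (2 * K)) l -> Clim (alt_mean g) l.
Proof.
  intros Hd He. apply Clim_of_even_odd; auto.
  apply Clim_Cmod in Hd.
  apply Clim_bound_0 with (fun M => Cmod (g M - g (S M) - RtoC 0)); auto.
  intros M. rewrite alt_mean_step.
  replace (g M - g (S M) - RtoC 0)%C with (g M - g (S M))%C by ring.
  rewrite Cmod_div, Cmod_mult, Cmod_pow_m1, Cmod_R, Rabs_right; [|lra|].
  - pose proof (Cmod_ge_0 (g M - g (S M))). lra.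
  - apply RtoC_neq; lra.
Qed.

Lemma alt_mean_plus (f g : nat -> C) (M : nat) :
  alt_mean (fun m => f m + g m)%C M = (alt_mean f M + alt_mean g M)%C.
Proof.
  unfold alt_mean.
  rewrite (csum_ext _ (fun m => RtoC (-1) ^ m * f m + RtoC (-1) ^ m * g m)%C)
    by (intros; ring).
  rewrite csum_plus. field.
Qed.

Lemma alt_mean_ext (f g : nat -> C) (M : nat) :
  (forall m, f m = g m) -> alt_mean f M = alt_mean g M.
Proof.
  intros H. unfold alt_mean. rewrite H. f_equal.
  apply csum_ext. intros; now rewrite H.
Qed.

(** * Second differences of powers times exponentials *)

(** Taylor expansion in the exponent: [p0 + p1 u + p2 u ^ 2] is a polynomial of
    degree two in [B + u], and the subtracted terms are the value and the
    differential at [u = 0] of its product with [exp (- s (B + u))]. *)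
Lemma expansion_bound (s B u p0 p1 p2 : C) :
  Cmod ((p0 + p1 * u + p2 * u ^ 2) * Cexp (- s * (B + u))
        - p0 * Cexp (- s * B) - u * (p1 - s * p0) * Cexp (- s * B)) <=
  Cmod (Cexp (- s * B)) * (Cmod u ^ 2 * exp (Cmod s * Cmod u) *
    (4 * Cmod p0 * Cmod s ^ 2 + 2 * Cmod p1 * Cmod s + Cmod p2)).
Proof.
  set (q := Cexp (- s * u)).
  assert (Hn : Cmod (- s * u) = Cmod s * Cmod u) by (now rewrite Cmod_mult, Cmod_opp).
  pose proof (Cexp_taylor1 (- s * u)) as T1.
  pose proof (Cexp_taylor2 (- s * u)) as T2.
  pose proof (Cmod_Cexp_le (- s * u)) as T0.
  rewrite Hn in T0, T1, T2. fold q in T0, T1, T2.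
  replace (- s * (B + u))%C with (- s * B + - s * u)%C by ring.
  rewrite Cexp_plus. fold q.
  replace (_ - _ - _)%C with (Cexp (- s * B) *
    (p0 * (q - RtoC 1 - - s * u) + (p1 * u * (q - RtoC 1) + p2 * (u * u) * q)))%C by ring.
  rewrite Cmod_mult. apply Rmult_le_compat_l; [apply Cmod_ge_0|].
  eapply Rle_trans; [apply Cmod_triangle|].
  eapply Rle_trans; [apply Rplus_le_compat_l, Cmod_triangle|].
  rewrite !Cmod_mult.
  pose proof (Cmod_ge_0 p0). pose proof (Cmod_ge_0 p1). pose proof (Cmod_ge_0 p2).
  pose proof (Cmod_ge_0 u). pose proof (Cmod_ge_0 s).
  set (e := exp (Cmod s * Cmod u)) in *.
  apply Rmult_le_compat_l with (r := Cmod p0) in T2; auto.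
  apply Rmult_le_compat_l with (r := Cmod p1 * Cmod u) in T1; [|now apply Rmult_le_pos].
  apply Rmult_le_compat_l with (r := Cmod p2 * (Cmod u * Cmod u)) in T0;
    [|repeat apply Rmult_le_pos; auto].
  eapply Rle_trans; [apply Rplus_le_compat; [exact T2|];
    apply Rplus_le_compat; [exact T1 | exact T0]|].
  right. ring.
Qed.

(** In the second difference the terms of order zero cancel, those of order one
    leave only [v - 2 u], itself a second difference of the exponents, and the
    remainders are quadratic. *)
Lemma second_diff_bound (s B u v p0 p1 p2 : C) (U V X : R) :
  Cmod u <= U -> Cmod v <= U -> Cmod (v - RtoC 2 * u) <= V ->
  Cmod p0 <= X -> Cmod p1 <= X -> Cmod p2 <= X ->
  Cmod (p0 * Cexp (- s * B)
        - RtoC 2 * ((p0 + p1 * u + p2 * u ^ 2) * Cexp (- s * (B + u)))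
        + (p0 + p1 * v + p2 * v ^ 2) * Cexp (- s * (B + v))) <=
  Cmod (Cexp (- s * B)) * X *
    (12 * (1 + Cmod s) ^ 2 * exp (Cmod s * U) * U ^ 2 + (1 + Cmod s) * V).
Proof.
  intros Hu Hv Huv H0 H1 H2.
  pose proof (Cmod_ge_0 p0). pose proof (Cmod_ge_0 p1). pose proof (Cmod_ge_0 p2).
  pose proof (Cmod_ge_0 u). pose proof (Cmod_ge_0 v). pose proof (Cmod_ge_0 s).
  set (E := Cmod (Cexp (- s * B))).
  assert (HE : 0 <= E) by apply Cmod_ge_0.
  assert (Aux : forall z, Cmod z <= U ->
    Cmod ((p0 + p1 * z + p2 * z ^ 2) * Cexp (- s * (B + z))
        - p0 * Cexp (- s * B) - z * (p1 - s * p0) * Cexp (- s * B)) <=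
    E * X * (4 * (1 + Cmod s) ^ 2 * exp (Cmod s * U) * U ^ 2)).
  { intros z Hz. eapply Rle_trans; [apply expansion_bound|]. fold E.
    rewrite (Rmult_assoc E X). apply Rmult_le_compat_l; auto.
    pose proof (Cmod_ge_0 z).
    replace (X * _) with (U ^ 2 * exp (Cmod s * U) * (4 * (1 + Cmod s) ^ 2 * X)) by ring.
    assert (0 <= Cmod z ^ 2) by (apply pow_le; auto).
    pose proof (exp_pos (Cmod s * Cmod z)).
    assert (exp (Cmod s * Cmod z) <= exp (Cmod s * U)).
    { apply exp_le, Rmult_le_compat_l; auto. }
    assert (Cmod z ^ 2 <= U ^ 2) by (apply pow_incr; auto).
    assert (0 <= Cmod p0 * Cmod s ^ 2) by (apply Rmult_le_pos; auto; apply pow_le; auto).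
    assert (0 <= Cmod p1 * Cmod s) by (apply Rmult_le_pos; auto).
    apply Rmult_le_compat.
    - apply Rmult_le_pos; lra.
    - lra.
    - apply Rmult_le_compat; lra.
    - assert (Cmod p0 * Cmod s ^ 2 <= X * Cmod s ^ 2)
        by (apply Rmult_le_compat_r; auto; apply pow_le; auto).
      assert (Cmod p1 * Cmod s <= X * Cmod s) by (apply Rmult_le_compat_r; auto).
      assert (0 <= X * Cmod s) by (apply Rmult_le_pos; lra).
      simpl in *. nra. }
  pose proof (Aux u Hu) as Au. pose proof (Aux v Hv) as Av. clear Aux.
  set (Du := (_ - _ - u * _ * _)%C) in Au.
  set (Dv := (_ - _ - v * _ * _)%C) in Av.
  replace (_ - _ + _)%C with
    (Dv + (- RtoC 2 * Du + (v - RtoC 2 * u) * (p1 - s * p0) * Cexp (- s * B)))%C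
    by (unfold Du, Dv; ring).
  eapply Rle_trans; [apply Cmod_triangle|].
  eapply Rle_trans; [apply Rplus_le_compat_l, Cmod_triangle|].
  rewrite !Cmod_mult. fold E. rewrite Cmod_opp, Cmod_R, (Rabs_right 2) by lra.
  assert (Hl : Cmod (v - RtoC 2 * u) * Cmod (p1 - s * p0) * E <= E * X * ((1 + Cmod s) * V)).
  { replace (E * X * _) with (V * ((1 + Cmod s) * X) * E) by ring.
    apply Rmult_le_compat_r; auto. apply Rmult_le_compat; auto using Cmod_ge_0.
    eapply Rle_trans; [apply Cmod_triangle|].
    rewrite Cmod_opp, Cmod_mult.
    assert (Cmod s * Cmod p0 <= Cmod s * X) by (apply Rmult_le_compat_l; auto). lra. }
  lra.
Qed.

(** * Sequences with logarithmic growth *)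

(** [L m] stays at bounded distance from [d * ln (m + 1)], and its first two
    differences are of the size of those of a logarithm.  The estimates use [L]
    through these bounds only, which are stable under sums and under finitely
    many changes. *)
Definition loglike (d : R) (L : nat -> C) : Prop :=
  exists K : R, forall m : nat,
    Cmod (L m - RtoC (d * ln (INR m + 1))) <= K /\
    Cmod (L (S m) - L m) <= K / (INR m + 1) /\
    Cmod (diff2 L m) <= K / (INR m + 1) ^ 2.

(** Up to the sign [(-1) ^ p], the [p]-th derivative in [s] of
    [exp (- s * L m)]; keeping [p] as a parameter treats the series, its derivative
    and the remainder of its first order expansion at once. *)
Definition Lexp (L : nat -> C) (p : nat) (s : C) (m : nat) : C :=
  (L m ^ p * Cexp (- s * L m))%C.

Lemma ln_INR_ge_0 (m : nat) : 0 <= ln (INR m + 1).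
Proof.
  pose proof (pos_INR m). rewrite <- ln_1. apply ln_le; lra.
Qed.

Lemma Cmod_Lexp0_le (d : R) (L : nat -> C) (K : R) (s : C) (m : nat) :
  Cmod (L m - RtoC (d * ln (INR m + 1))) <= K ->
  Cmod (Cexp (- s * L m)) <= exp (Cmod s * K) * exp (- Re s * d * ln (INR m + 1)).
Proof.
  intros H. rewrite Cmod_Cexp, <- exp_plus. apply exp_le.
  set (r := (L m - RtoC (d * ln (INR m + 1)))%C) in *.
  replace (L m) with (r + RtoC (d * ln (INR m + 1)))%C by (unfold r; ring).
  replace (Re (- s * (r + RtoC (d * ln (INR m + 1)))))
    with (Re (- s * r) + - Re s * d * ln (INR m + 1)).
  2:{ unfold Re; simpl; ring. }
  apply Rplus_le_compat_r.
  eapply Rle_trans; [apply Rle_abs|].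
  eapply Rle_trans; [apply re_le_Cmod|].
  rewrite Cmod_mult, Cmod_opp. apply Rmult_le_compat_l; auto using Cmod_ge_0.
Qed.

(** With [l = ln x], the square of a logarithm is absorbed by a fourth root of
    [x]. *)
Lemma log_sq_absorb (a b l : R) :
  0 <= a -> 0 <= b -> 0 <= l ->
  (a + b * l) ^ 2 <= (a + 8 * b) ^ 2 * exp (l / 4).
Proof.
  intros Ha Hb Hl.
  replace (exp (l / 4)) with (exp (l / 8) ^ 2).
  2:{ simpl. rewrite Rmult_1_r, <- exp_plus. f_equal. lra. }
  rewrite <- Rpow_mult_distr. apply pow_incr.
  pose proof (exp_ineq1_le (l / 8)) as He.
  split.
  - apply Rplus_le_le_0_compat; auto. now apply Rmult_le_pos.
  - assert (a * 1 <= a * exp (l / 8)) by (apply Rmult_le_compat_l; lra).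
    assert (8 * b * (l / 8) <= 8 * b * exp (l / 8)) by (apply Rmult_le_compat_l; lra).
    nra.
Qed.

Lemma exp_half_ln (x : R) : 0 < x -> exp (ln x / 2) = sqrt x.
Proof.
  intros Hx. symmetry. apply sqrt_lem_1; [lra | left; apply exp_pos|].
  rewrite <- exp_plus. replace (ln x / 2 + ln x / 2) with (ln x) by lra.
  now apply exp_ln.
Qed.

(** The second difference of [L ^ p * exp (- s * L)] is at most
    [(m + 1) ^ (-2)] times the square of a logarithm and [exp (- Re (s * L m))].  On
    [Re s >= - 1 / (4 d)] the exponential is [O ((m + 1) ^ (1 / 4))], and the
    logarithms cost another [(m + 1) ^ (1 / 4)]. *)
Lemma diff2_Lexp_bound (d : R) (L : nat -> C) (S0 : R) :
  0 < d -> 0 <= S0 -> loglike d L ->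
  exists K, 0 <= K /\ forall p s m, (p <= 2)%nat ->
    Cmod s <= S0 -> - (1 / (4 * d)) <= Re s ->
    Cmod (diff2 (Lexp L p s) m) <= K * w32 m.
Proof.
  intros Hd HS [K0 HL].
  assert (HK0 : 0 <= K0).
  { destruct (HL O) as [H _]. pose proof (Cmod_ge_0 (L O - RtoC (d * ln (INR 0 + 1)))). lra. }
  set (K1 := 12 * (1 + S0) ^ 2 * exp (S0 * (2 * K0)) * (2 * K0) ^ 2 + (1 + S0) * K0).
  set (K2 := 2 * (1 + K0 + 8 * d) ^ 2).
  assert (HK1 : 0 <= K1).
  { unfold K1. pose proof (exp_pos (S0 * (2 * K0))).
    apply Rplus_le_le_0_compat; repeat apply Rmult_le_pos; try lra; apply pow_le; lra. }
  assert (HK2 : 0 <= K2).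
  { unfold K2. apply Rmult_le_pos; [lra|]. apply pow2_ge_0. }
  exists (exp (S0 * K0) * K2 * K1). split.
  { apply Rmult_le_pos; auto. apply Rmult_le_pos; auto. left; apply exp_pos. }
  intros p s m Hp Hs Hre.
  destruct (HL m) as (H1 & H2 & H3). destruct (HL (S m)) as (_ & H2' & _).
  set (B := L m) in *.
  pose proof (pos_INR m) as Hm. pose proof (ln_INR_ge_0 m) as Hl.
  set (x := INR m + 1) in *. set (l := ln x) in *.
  assert (Hx : 1 <= x) by (unfold x; lra).
  (* The exponents are expanded around the first of the three, [B]. *)
  set (u := (L (S m) - B)%C) in *. set (v := (L (S (S m)) - B)%C).
  assert (Hu : Cmod u <= 2 * K0 / x).
  { eapply Rle_trans; [exact H2|]. apply Rmult_le_compat_r; [|lra].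
    left; apply Rinv_0_lt_compat; lra. }
  assert (Hv : Cmod v <= 2 * K0 / x).
  { replace v with ((L (S (S m)) - L (S m)) + u)%C by (unfold v, u; ring).
    eapply Rle_trans; [apply Cmod_triangle|].
    replace (2 * K0 / x) with (K0 / x + K0 / x) by (field; lra).
    apply Rplus_le_compat; auto. eapply Rle_trans; [exact H2'|].
    apply Rmult_le_compat_l; auto. rewrite S_INR. fold x.
    apply Rinv_le_contravar; lra. }
  assert (Huv : Cmod (v - RtoC 2 * u) <= K0 / x ^ 2).
  { replace (v - RtoC 2 * u)%C with (diff2 L m); [exact H3|].
    unfold diff2, v, u, B. ring. }
  assert (HB : Cmod B <= K0 + d * l).
  { replace B with ((B - RtoC (d * l)) + RtoC (d * l))%C by ring.
    eapply Rle_trans; [apply Cmod_triangle|]. rewrite Cmod_R, (Rabs_right (d * l)).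
    - now apply Rplus_le_compat_r.
    - apply Rle_ge, Rmult_le_pos; lra. }
  set (X := 2 * (1 + K0 + d * l) ^ 2).
  assert (HX : 1 <= (1 + K0 + d * l)).
  { assert (0 <= d * l) by (apply Rmult_le_pos; lra). lra. }
  (* [X] bounds the coefficients of the powers [0], [1] and [2] of [B + z]. *)
  assert (Hpoly : exists p0 p1 p2 : C, Cmod p0 <= X /\ Cmod p1 <= X /\ Cmod p2 <= X /\
     forall z, ((B + z) ^ p)%C = (p0 + p1 * z + p2 * z ^ 2)%C).
  { pose proof (Cmod_ge_0 B).
    destruct p as [|[|[|p]]]; [| | |lia].
    - exists (RtoC 1), (RtoC 0), (RtoC 0). rewrite Cmod_1, Cmod_0.
      unfold X. repeat split; try (simpl; nra). intros z; simpl; ring.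
    - exists B, (RtoC 1), (RtoC 0). rewrite Cmod_1, Cmod_0.
      unfold X. repeat split; try (simpl; nra). intros z; simpl; ring.
    - exists (B ^ 2)%C, (RtoC 2 * B)%C, (RtoC 1).
      rewrite Cmod_pow, Cmod_mult, Cmod_1, Cmod_R, (Rabs_right 2) by lra.
      unfold X. repeat split; try (simpl; nra). intros z; simpl.
      replace (RtoC 2) with (RtoC 1 + RtoC 1)%C
        by (apply C_ext; unfold Re, Im; simpl; ring).
      ring. }
  destruct Hpoly as (p0 & p1 & p2 & P0 & P1 & P2 & HP).
  pose proof (second_diff_bound s B u v p0 p1 p2 _ _ X Hu Hv Huv P0 P1 P2) as Main.
  replace (diff2 (Lexp L p s) m) with
    (p0 * Cexp (- s * B)
        - RtoC 2 * ((p0 + p1 * u + p2 * u ^ 2) * Cexp (- s * (B + u)))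
        + (p0 + p1 * v + p2 * v ^ 2) * Cexp (- s * (B + v)))%C.
  2:{ assert (HP0 : (B ^ p)%C = p0).
      { rewrite <- (Cplus_0_r B), HP. ring. }
      rewrite <- (HP u), <- (HP v), <- HP0. unfold diff2, Lexp.
      replace (B + u)%C with (L (S m)) by (unfold u; ring).
      replace (B + v)%C with (L (S (S m))) by (unfold v; ring).
      reflexivity. }
  eapply Rle_trans; [exact Main|]. clear Main.
  assert (HE : Cmod (Cexp (- s * B)) <= exp (S0 * K0) * exp (l / 4)).
  { eapply Rle_trans; [apply (Cmod_Lexp0_le d L K0 s m H1)|].
    apply Rmult_le_compat; try (left; apply exp_pos).
    - apply exp_le, Rmult_le_compat_r; auto.
    - apply exp_le. fold x. fold l.
      assert (- Re s * d <= 1 / 4).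
      { replace (1 / 4) with (1 / (4 * d) * d) by (field; lra).
        apply Rmult_le_compat_r; lra. }
      assert (- Re s * d * l <= 1 / 4 * l) by (apply Rmult_le_compat_r; auto). lra. }
  assert (HX2 : X <= K2 * exp (l / 4)).
  { unfold X, K2. rewrite Rmult_assoc. apply Rmult_le_compat_l; [lra|].
    apply log_sq_absorb; lra. }
  assert (Hbr : 12 * (1 + Cmod s) ^ 2 * exp (Cmod s * (2 * K0 / x)) * (2 * K0 / x) ^ 2 +
     (1 + Cmod s) * (K0 / x ^ 2) <= K1 / x ^ 2).
  { unfold K1. pose proof (Cmod_ge_0 s).
    replace ((2 * K0 / x) ^ 2) with ((2 * K0) ^ 2 / x ^ 2) by (field; lra).
    apply Rle_trans with
      (12 * (1 + S0) ^ 2 * exp (S0 * (2 * K0)) * ((2 * K0) ^ 2 / x ^ 2) +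
       (1 + S0) * (K0 / x ^ 2)); [|right; field; lra].
    assert (0 < / x ^ 2) by (apply Rinv_0_lt_compat, pow_lt; lra).
    apply Rplus_le_compat.
    - apply Rmult_le_compat_r.
      { apply Rmult_le_pos; [apply pow2_ge_0 | lra]. }
      apply Rmult_le_compat.
      + apply Rmult_le_pos; [lra | apply pow2_ge_0].
      + left; apply exp_pos.
      + apply Rmult_le_compat_l; [lra|]. apply pow_incr; lra.
      + apply exp_le. apply Rmult_le_compat; auto.
        * apply Rmult_le_pos; [lra|]. left; apply Rinv_0_lt_compat; lra.
        * unfold Rdiv. rewrite <- (Rmult_1_r (2 * K0)) at 2.
          apply Rmult_le_compat_l; [lra|]. rewrite <- Rinv_1.
          apply Rinv_le_contravar; lra.
    - apply Rmult_le_compat_r; [|lra]. apply Rmult_le_pos; lra. }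
  assert (Hw : w32 m = exp (l / 4) * exp (l / 4) / x ^ 2).
  { unfold w32. fold x. rewrite <- exp_plus.
    replace (l / 4 + l / 4) with (ln x / 2) by (unfold l; lra).
    rewrite exp_half_ln by lra.
    assert (Er : forall r, 0 < r -> r * r = x -> / (x * r) = r / x ^ 2).
    { intros r Hr E. rewrite <- E. field. lra. }
    apply Er; [apply sqrt_lt_R0; lra | apply sqrt_sqrt; lra]. }
  rewrite Hw.
  replace (exp (S0 * K0) * K2 * K1 * (exp (l / 4) * exp (l / 4) / x ^ 2)) with
    ((exp (S0 * K0) * exp (l / 4)) * (K2 * exp (l / 4)) * (K1 / x ^ 2))
    by (field; lra).
  apply Rmult_le_compat; auto.
  - apply Rmult_le_pos; [apply Cmod_ge_0|]. unfold X. apply Rmult_le_pos; [lra|].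
    apply pow2_ge_0.
  - assert (0 < / x) by (apply Rinv_0_lt_compat; lra).
    assert (0 < / x ^ 2) by (apply Rinv_0_lt_compat, pow_lt; lra).
    pose proof (Cmod_ge_0 s). pose proof (exp_pos (Cmod s * (2 * K0 / x))).
    apply Rplus_le_le_0_compat.
    + apply Rmult_le_pos; [|apply pow2_ge_0].
      apply Rmult_le_pos; [|lra]. apply Rmult_le_pos; [lra|apply pow2_ge_0].
    + apply Rmult_le_pos; [lra|]. apply Rmult_le_pos; lra.
  - apply Rmult_le_compat; auto; [apply Cmod_ge_0|].
    unfold X. apply Rmult_le_pos; [lra|]. apply pow2_ge_0.
Qed.

(** * The alternating zeta function of a logarithmic sequence *)

Definition Clim_seq (u : nat -> C) : C :=
  (real (Lim_seq (fun n => Re (u n))), real (Lim_seq (fun n => Im (u n)))).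

Lemma Clim_seq_eq (u : nat -> C) (l : C) : Clim u l -> Clim_seq u = l.
Proof.
  intros [A B]. unfold Clim_seq.
  apply is_lim_seq_unique in A, B. rewrite A, B. now destruct l.
Qed.

(** The analytic continuation of the alternating series of [exp (- s * L m)]. *)
Definition alt_zeta (L : nat -> C) (s : C) : C :=
  Clim_seq (fun K => alt_mean (Lexp L 0 s) (2 * K)).

Lemma path_derive_ext (f g : R -> C) (t : R) (l : C) :
  (forall t, f t = g t) -> path_derive f t l -> path_derive g t l.
Proof.
  intros E [A B]; split; (eapply is_derive_ext; [|eassumption]);
    intros x; cbv beta; now rewrite E.
Qed.

Lemma Lexp_path_derive (L : nat -> C) (p : nat) (s0 sigma : C) (m : nat) (t : R) :
  path_derive (fun t => Lexp L p (s0 + RtoC t * sigma) m) t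
    (- sigma * Lexp L (S p) (s0 + RtoC t * sigma) m).
Proof.
  unfold Lexp.
  assert (E : forall t, (- (s0 + RtoC t * sigma) * L m)%C =
    (- s0 * L m + RtoC t * (- sigma * L m))%C) by (intros; ring).
  rewrite E.
  replace (- sigma * (L m ^ S p * _))%C with (L m ^ p * ((- sigma * L m) *
    Cexp (- s0 * L m + RtoC t * (- sigma * L m))))%C by (rewrite Cpow_S; ring).
  eapply path_derive_ext; [|apply path_derive_scal, path_derive_Cexp].
  intros x; cbv beta. now rewrite E.
Qed.

Lemma alt_mean_path_derive (f df : R -> nat -> C) (t : R) (M : nat) :
  (forall m, path_derive (fun t => f t m) t (df t m)) ->
  path_derive (fun t => alt_mean (f t) M) t (alt_mean (df t) M).
Proof.
  intros H. unfold alt_mean. apply path_derive_plus.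
  - induction M as [|M IH]; simpl; [apply path_derive_const|].
    apply path_derive_plus; auto. now apply path_derive_scal.
  - apply path_derive_ext with (fun t => RtoC (-1) ^ M / RtoC 2 * f t M)%C.
    + intros x. field.
    + replace (RtoC (-1) ^ M * df t M / RtoC 2)%C with
        (RtoC (-1) ^ M / RtoC 2 * df t M)%C by field.
      now apply path_derive_scal.
Qed.

Lemma alt_mean_scal (c : C) (g : nat -> C) (M : nat) :
  alt_mean (fun m => c * g m)%C M = (c * alt_mean g M)%C.
Proof.
  unfold alt_mean.
  rewrite (csum_ext _ (fun m => c * (RtoC (-1) ^ m * g m))%C) by (intros; ring).
  rewrite csum_scal. field.
Qed.

Lemma w32_double (k : nat) : w32 (2 * k) <= w32 k.
Proof.
  unfold w32. pose proof (pos_INR k).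
  assert (INR k <= INR (2 * k)) by (apply le_INR; lia).
  apply Rinv_le_contravar.
  - apply Rmult_lt_0_compat; [lra | apply sqrt_lt_R0; lra].
  - apply Rmult_le_compat; try lra; [apply sqrt_pos | apply sqrt_le_1; lra].
Qed.

Lemma Cmod_Lexp_le (L : nat -> C) (p : nat) (s : C) (m : nat) (S0 : R) :
  Cmod s <= S0 -> Cmod (Lexp L p s m) <= Cmod (L m) ^ p * exp (S0 * Cmod (L m)).
Proof.
  intros Hs. unfold Lexp. rewrite Cmod_mult, Cmod_pow.
  apply Rmult_le_compat_l; [apply pow_le, Cmod_ge_0|].
  eapply Rle_trans; [apply Cmod_Cexp_le|]. apply exp_le.
  rewrite Cmod_mult, Cmod_opp. apply Rmult_le_compat_r; auto using Cmod_ge_0.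
Qed.

Lemma alt_mean_Lexp_bounded (d : R) (L : nat -> C) (p : nat) (S0 : R) :
  0 < d -> loglike d L -> (p <= 2)%nat -> 0 <= S0 ->
  exists M, forall s K, Cmod s <= S0 -> - (1 / (4 * d)) <= Re s ->
    Cmod (alt_mean (Lexp L p s) (2 * K)) <= M.
Proof.
  intros Hd HL Hp HS.
  destruct (diff2_Lexp_bound d L S0 Hd HS HL) as (K0 & HK0 & H).
  exists (Cmod (L O) ^ p * exp (S0 * Cmod (L O)) / 2 + 3 * K0 / 2).
  intros s K Hs Hre. rewrite alt_mean_even.
  eapply Rle_trans; [apply Cmod_triangle|].
  rewrite !Cmod_div, Cmod_R, (Rabs_right 2) by (lra || (apply RtoC_neq; lra)).
  apply Rplus_le_compat; (apply Rmult_le_compat_r; [lra|]).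
  - now apply Cmod_Lexp_le.
  - apply dominated_csum_le; auto. intros k.
    eapply Rle_trans; [now apply H|].
    apply Rmult_le_compat_l; auto using w32_double.
Qed.

Lemma alt_mean_Lexp_cv (d : R) (L : nat -> C) (p : nat) (s : C) :
  0 < d -> loglike d L -> (p <= 2)%nat -> - (1 / (4 * d)) <= Re s ->
  exists l, Clim (fun K => alt_mean (Lexp L p s) (2 * K)) l.
Proof.
  intros Hd HL Hp Hs.
  destruct (diff2_Lexp_bound d L (Cmod s) Hd (Cmod_ge_0 s) HL) as (K & HK & H).
  destruct (dominated_csum_cv (fun k => diff2 (Lexp L p s) (2 * k)) K) as [l Hl].
  { intros k. eapply Rle_trans; [apply H; auto; lra|].
    apply Rmult_le_compat_l; auto using w32_double. }
  exists (Lexp L p s 0 / RtoC 2 + / RtoC 2 * l)%C.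
  eapply Clim_ext; [intros n; symmetry; apply alt_mean_even|].
  apply Clim_plus; [apply Clim_const|].
  eapply Clim_ext; [|apply Clim_scal, Hl]. intros n; cbv beta; unfold Cdiv; ring.
Qed.

Lemma alt_zeta_Clim (d : R) (L : nat -> C) (s : C) :
  0 < d -> loglike d L -> - (1 / (4 * d)) <= Re s ->
  Clim (fun K => alt_mean (Lexp L 0 s) (2 * K)) (alt_zeta L s).
Proof.
  intros Hd HL Hs. destruct (alt_mean_Lexp_cv d L 0 s) as [l Hl]; auto.
  unfold alt_zeta. now rewrite (Clim_seq_eq _ _ Hl).
Qed.

(** The second derivatives in [s] of the means are uniformly bounded near [s0],
    being means of [L ^ 2 * exp (- s * L)]; so their first order expansions have
    uniformly quadratic remainders, and pass to the limit. *)
Lemma alt_zeta_derive (d : R) (L : nat -> C) (s0 l : C) :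
  0 < d -> loglike d L -> - (1 / (8 * d)) < Re s0 ->
  Clim (fun K => alt_mean (Lexp L 1 s0) (2 * K)) l ->
  is_derive (K := C_AbsRing) (V := C_NormedModule) (alt_zeta L) s0 (- l)%C.
Proof.
  intros Hd HL Hs0 Hl.
  set (delta := 1 / (8 * d)) in *.
  assert (Hdelta : 0 < delta) by (apply Rdiv_lt_0_compat; lra).
  assert (H4 : 1 / (4 * d) = 2 * delta) by (unfold delta; field; lra).
  assert (HD : forall s, Cmod (s - s0) < delta -> - (1 / (4 * d)) <= Re s).
  { intros s Hs. rewrite H4. pose proof (re_le_Cmod (s - s0)) as A.
    pose proof (Rabs_maj2 (Re (s - s0)%C)) as B.
    change (Re (s - s0)%C) with (Re s - Re s0) in *. lra. }
  destruct (alt_mean_Lexp_bounded d L 2 (Cmod s0 + delta)) as [M HM]; auto.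
  { pose proof (Cmod_ge_0 s0); lra. }
  assert (HM0 : 0 <= M).
  { eapply Rle_trans; [apply Cmod_ge_0|]. apply (HM s0 O); [lra|].
    apply HD. replace (s0 - s0)%C with (RtoC 0) by ring. now rewrite Cmod_0. }
  apply limit_derive with (u := fun K s => alt_mean (Lexp L 0 s) (2 * K))
    (du := fun K => (-(1) * alt_mean (Lexp L 1 s0) (2 * K))%C)
    (delta := delta) (M := 4 * M); auto; [lra | | |].
  - intros K s Hs. set (sigma := (s - s0)%C) in *.
    pose (f := fun (p : nat) (t : R) =>
      alt_mean (Lexp L p (s0 + RtoC t * sigma)) (2 * K)).
    assert (Hf : forall p t, path_derive (f p) t (- sigma * f (S p) t)%C).
    { intros p t. unfold f. rewrite <- alt_mean_scal.
      apply (alt_mean_path_derive (fun t => Lexp L p (s0 + RtoC t * sigma))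
        (fun t m => - sigma * Lexp L (S p) (s0 + RtoC t * sigma) m)%C).
      intros m. apply Lexp_path_derive. }
    replace (4 * M * Cmod sigma ^ 2) with (4 * (Cmod sigma ^ 2 * M)) by ring.
    replace (_ - _ - _)%C with (f 0%nat 1 - f 0%nat 0 - (- sigma * f 1%nat 0))%C.
    2:{ unfold f. replace (s0 + RtoC 1 * sigma)%C with s by (unfold sigma; ring).
        replace (s0 + RtoC 0 * sigma)%C with s0 by ring. ring. }
    apply path_taylor2 with (df := fun t => (- sigma * f 1%nat t)%C)
      (ddf := fun t => (- sigma * (- sigma * f 2%nat t))%C); auto.
    intros t Ht. split; [now apply path_derive_scal|].
    replace (- sigma * (- sigma * f 2%nat t))%C with (sigma ^ 2 * f 2%nat t)%C
      by (simpl; ring).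
    rewrite Cmod_mult, Cmod_pow. apply Rmult_le_compat_l; [apply pow_le, Cmod_ge_0|].
    assert (Hts : Cmod (RtoC t * sigma) < delta).
    { rewrite Cmod_mult, Cmod_R. apply Rle_lt_trans with (1 * Cmod sigma); [|lra].
      apply Rmult_le_compat_r; auto using Cmod_ge_0. }
    apply HM.
    + eapply Rle_trans; [apply Cmod_triangle|]. lra.
    + apply HD. now replace (s0 + RtoC t * sigma - s0)%C with (RtoC t * sigma)%C by ring.
  - intros s Hs. now apply alt_zeta_Clim with d; auto.
  - replace (- l)%C with (-(1) * l)%C by ring. now apply Clim_scal.
Qed.

(** For [Re s > 0] the terms vanish at infinity, so the means and the partial
    sums have the same limit. *)
Lemma alt_zeta_series (d : R) (L : nat -> C) (s : C) :
  0 < d -> loglike d L -> 0 < Re s ->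
  Clim (csum (fun m => RtoC (-1) ^ m * Cexp (- s * L m))%C) (alt_zeta L s).
Proof.
  intros Hd HL Hs.
  assert (Hg : Clim (Lexp L 0 s) (RtoC 0)).
  { destruct HL as [K0 HK].
    apply Clim_bound_0 with (fun m => exp (Cmod s * K0) *
      exp (- Re s * d * ln (INR m + 1))).
    - intros m. unfold Lexp. rewrite Cmult_1_l. apply Cmod_Lexp0_le. apply HK.
    - replace (Finite 0) with (Rbar_mult (exp (Cmod s * K0)) 0)
        by (simpl; f_equal; ring).
      apply is_lim_seq_scal_l.
      apply (is_lim_comp_seq exp _ m_infty); [apply is_lim_exp_m | |].
      + exists 0%nat. discriminate.
      + replace m_infty with (Rbar_mult (- Re s * d) p_infty).
        2:{ assert (Hneg : - Re s * d < 0) by nra.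
            apply is_Rbar_mult_unique, is_Rbar_mult_sym.
            now apply is_Rbar_mult_p_infty_neg. }
        apply is_lim_seq_scal_l.
        apply (is_lim_comp_seq ln _ p_infty); [apply is_lim_ln_p | |].
        * exists 0%nat. discriminate.
        * apply is_lim_seq_ext with (fun m => INR (S m)); [apply S_INR|].
          apply (is_lim_seq_incr_1 INR). apply is_lim_seq_INR. }
  assert (Hg1 : Clim (fun M => Lexp L 0 s (S M)) (RtoC 0)) by now apply Clim_S.
  assert (HA : Clim (alt_mean (Lexp L 0 s)) (alt_zeta L s)).
  { apply alt_mean_Clim.
    - replace (RtoC 0) with (RtoC 0 - RtoC 0)%C by ring. now apply Clim_minus.
    - apply alt_zeta_Clim with d; auto.
      assert (0 < 1 / (4 * d)) by (apply Rdiv_lt_0_compat; lra). lra. }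
  apply Clim_ext with (fun M => alt_mean (Lexp L 0 s) M
    - / RtoC 2 * (RtoC (-1) ^ M * Lexp L 0 s M))%C.
  - intros M. unfold alt_mean.
    rewrite (csum_ext _ (fun m => RtoC (-1) ^ m * Cexp (- s * L m))%C).
    + field.
    + intros k _. unfold Lexp. rewrite Cmult_1_l. reflexivity.
  - replace (alt_zeta L s) with (alt_zeta L s - / RtoC 2 * RtoC 0)%C by ring.
    apply Clim_minus; auto. apply Clim_scal.
    apply Clim_Cmod in Hg.
    apply Clim_bound_0 with (fun M => Cmod (Lexp L 0 s M - RtoC 0)); auto.
    intros M. rewrite Cmod_mult, Cmod_pow_m1. right.
    replace (Lexp L 0 s M - RtoC 0)%C with (Lexp L 0 s M) by ring. ring.
Qed.

Lemma alt_mean_log_cv (d : R) (L : nat -> C) :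
  0 < d -> loglike d L -> exists l, Clim (fun K => alt_mean L (2 * K)) l.
Proof.
  intros Hd HL. destruct (alt_mean_Lexp_cv d L 1 (RtoC 0)) as [l Hl]; auto.
  { unfold Re; simpl. assert (0 < 1 / (4 * d)) by (apply Rdiv_lt_0_compat; lra). lra. }
  exists l. eapply Clim_ext; [|exact Hl]. intros K; cbv beta.
  apply alt_mean_ext. intros m. unfold Lexp.
  replace (- RtoC 0 * L m)%C with (RtoC 0) by ring. rewrite Cexp_0. simpl; ring.
Qed.

(** At [s = 0] the derivative of [exp (- s * L m)] is [- L m], so that minus the
    derivative of the continuation is the limit of the means of [L].  The disc of
    radius [1 / (8 d)] lies in the half-plane where the continuation is
    holomorphic. *)
Lemma loglike_zeta_value (d : R) (L : nat -> C) (l : C) (pw : nat -> C -> C) :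
  0 < d -> loglike d L -> Clim (fun K => alt_mean L (2 * K)) l ->
  (forall m s, pw m s = Cexp (- s * L m)) ->
  is_alt_zeta_value pw (Cexp l).
Proof.
  intros Hd HL Hl Hpw.
  assert (Hr : 0 < 1 / (8 * d)) by (apply Rdiv_lt_0_compat; lra).
  exists (alt_zeta L), (mkposreal _ Hr). split; [|split].
  - intros s Hs. apply is_series_Clim.
    eapply Clim_ext; [|now apply alt_zeta_series with d].
    intros n. apply csum_ext. intros; now rewrite Hpw.
  - intros s Hs.
    assert (Hs' : - (1 / (8 * d)) < Re s).
    { destruct Hs as [Hs|Hs]; [lra|]. simpl in Hs.
      pose proof (re_le_Cmod s). pose proof (Rabs_maj2 (Re s)). lra. }
    destruct (alt_mean_Lexp_cv d L 1 s) as [l1 Hl1]; auto.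
    { replace (1 / (4 * d)) with (2 * (1 / (8 * d))) by (field; lra). lra. }
    exists (- l1)%C. now apply alt_zeta_derive with d.
  - rewrite (is_C_derive_unique (alt_zeta L) (RtoC 0) (- l)%C).
    + f_equal. ring.
    + apply alt_zeta_derive with d; auto; [unfold Re; simpl; lra|].
      eapply Clim_ext; [|exact Hl]. intros K; cbv beta.
      apply alt_mean_ext. intros m. unfold Lexp.
      replace (- RtoC 0 * L m)%C with (RtoC 0) by ring. rewrite Cexp_0. simpl; ring.
Qed.

(** * The principal logarithm *)

Lemma Cmod_sqr (z : C) : Cmod z * Cmod z = Re z * Re z + Im z * Im z.
Proof. pose proof (Cmod2_alt z) as H. simpl in H. lra. Qed.

Lemma Re_div_Cmod_bound (z : C) : z <> RtoC 0 -> -1 <= Re z / Cmod z <= 1.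
Proof.
  intros Hz. apply Cmod_gt_0 in Hz.
  pose proof (re_le_Cmod z) as H. apply Rabs_le_between in H.
  split.
  - apply Rmult_le_reg_r with (Cmod z); auto. unfold Rdiv.
    rewrite Rmult_assoc, Rinv_l by lra. lra.
  - apply Rmult_le_reg_r with (Cmod z); auto. unfold Rdiv.
    rewrite Rmult_assoc, Rinv_l by lra. lra.
Qed.

Lemma sin_acos_Cmod (z : C) : z <> RtoC 0 ->
  sin (acos (Re z / Cmod z)) = Rabs (Im z) / Cmod z.
Proof.
  intros Hz. rewrite sin_acos by now apply Re_div_Cmod_bound.
  apply Cmod_gt_0 in Hz. pose proof (Cmod_sqr z) as E.
  replace (1 - (Re z / Cmod z)²) with ((Im z / Cmod z)²).
  - rewrite sqrt_Rsqr_abs. unfold Rdiv. rewrite Rabs_mult. f_equal.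
    apply Rabs_right. left. now apply Rinv_0_lt_compat.
  - unfold Rsqr. replace (1 - _) with
      ((Cmod z * Cmod z - Re z * Re z) / (Cmod z * Cmod z)) by (field; lra).
    rewrite E at 1. field. lra.
Qed.

Lemma Cexp_Clog (z : C) : z <> RtoC 0 -> Cexp (Clog z) = z.
Proof.
  intros Hz. pose proof (sin_acos_Cmod z Hz) as Hs.
  pose proof (cos_acos _ (Re_div_Cmod_bound z Hz)) as Hc.
  apply Cmod_gt_0 in Hz.
  unfold Clog, Cexp, Carg. cbn [Re Im fst snd]. rewrite exp_ln by auto.
  apply C_ext; cbn [Re Im fst snd]; destruct (Rle_dec 0 (Im z)) as [Hi|Hi];
    rewrite ?cos_neg, ?sin_neg, ?Hc, ?Hs.
  - unfold Re; simpl. field. lra.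
  - unfold Re; simpl. field. lra.
  - rewrite Rabs_right by lra. unfold Im; simpl. field. lra.
  - rewrite Rabs_left by lra. unfold Im; simpl. field. lra.
Qed.

Lemma Carg_bound (z : C) : z <> RtoC 0 -> - PI < Carg z <= PI.
Proof.
  intros Hz. pose proof (Re_div_Cmod_bound z Hz) as Hb. unfold Carg.
  pose proof (acos_bound (Re z / Cmod z)) as Ha.
  pose proof PI_RGT_0.
  destruct (Rle_dec 0 (Im z)) as [Hi|Hi]; [lra|].
  split; [|lra].
  destruct (Req_dec (acos (Re z / Cmod z)) PI) as [E|E]; [|lra].
  pose proof (sin_acos_Cmod z Hz) as Hs. rewrite E, sin_PI in Hs.
  rewrite Rabs_left in Hs by lra. apply Cmod_gt_0 in Hz.
  assert (0 < - Im z / Cmod z) by (apply Rdiv_lt_0_compat; lra). lra.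
Qed.

Lemma cos_eq_1_small (t : R) : cos t = 1 -> Rabs t < 2 * PI -> t = 0.
Proof.
  intros Hc Ht.
  destruct (Req_dec t 0) as [|Hn]; auto. exfalso.
  assert (Aux : forall r, 0 < r -> r < 2 * PI -> cos r = 1 -> False).
  { intros r Hr1 Hr2 E.
    assert (0 < sin (r / 2)) by (apply sin_gt_0; lra).
    replace r with (2 * (r / 2)) in E by lra. rewrite cos_2a_sin in E. nra. }
  apply Rabs_def2 in Ht. destruct (Rlt_dec 0 t).
  - apply (Aux t); lra.
  - apply (Aux (- t)); [lra | lra | now rewrite cos_neg].
Qed.

Lemma Cexp_inj_strip (v w : C) :
  Cexp v = Cexp w -> Rabs (Im v - Im w) < 2 * PI -> v = w.
Proof.
  intros E Hb.
  assert (ER : Re v = Re w).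
  { apply exp_inv. rewrite <- !Cmod_Cexp. now rewrite E. }
  unfold Cexp in E. rewrite ER in E. injection E as E1 E2.
  pose proof (exp_pos (Re w)).
  apply Rmult_eq_reg_l in E1, E2; try lra.
  apply C_ext; auto.
  cut (Im v - Im w = 0); [lra|]. apply cos_eq_1_small; auto.
  rewrite cos_minus, E1, E2. pose proof (sin2_cos2 (Im w)) as Hsc.
  unfold Rsqr in Hsc. lra.
Qed.

(** Half of the logarithm of the squared modulus and an arctangent: the form of
    the principal logarithm on the right half-plane that one can differentiate
    mechanically. *)
Definition Clog_atan (z : C) : C :=
  (ln (Re z * Re z + Im z * Im z) / 2, atan (Im z / Re z)).

Lemma Clog_atan_eq (z : C) : 0 < Re z -> Clog z = Clog_atan z.
Proof.
  intros Hre.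
  assert (Hz : z <> RtoC 0).
  { intros ->. unfold Re in Hre; simpl in Hre; lra. }
  assert (Hm : 0 < Cmod z) by now apply Cmod_gt_0.
  pose proof (Cmod_sqr z) as E.
  assert (El : ln (Re z * Re z + Im z * Im z) / 2 = ln (Cmod z)).
  { rewrite <- E, ln_mult by auto. lra. }
  apply Cexp_inj_strip.
  - rewrite Cexp_Clog by auto. unfold Cexp, Clog_atan. cbn [Re Im fst snd].
    rewrite El, exp_ln, cos_atan, sin_atan by auto.
    assert (Es : sqrt (1 + (Im z / Re z)²) = Cmod z / Re z).
    { apply sqrt_lem_1.
      - pose proof (Rle_0_sqr (Im z / Re z)). lra.
      - left. now apply Rdiv_lt_0_compat.
      - unfold Rsqr. replace (Cmod z / Re z * (Cmod z / Re z)) with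
          (Cmod z * Cmod z / (Re z * Re z)) by (field; lra).
        rewrite E. field. lra. }
    rewrite Es. apply C_ext; cbn [Re Im fst snd]; unfold Re, Im in *; simpl; field; lra.
  - change (Rabs (Carg z - atan (Im z / Re z)) < 2 * PI).
    pose proof (Carg_bound z Hz). pose proof (atan_bound (Im z / Re z)).
    pose proof PI_RGT_0. apply Rabs_def1; lra.
Qed.

Lemma Clog_atan_path_derive (z : C) (tau t : R) :
  0 < Re z + t * tau ->
  path_derive (fun t => Clog_atan (z + RtoC (t * tau))) t
    (RtoC tau * / (z + RtoC (t * tau))).
Proof.
  intros H. unfold Re in H.
  assert (0 < fst z + t * tau * 1) by lra.
  assert (P : 0 < (fst z + t * tau) * (fst z + t * tau) + (snd z + 0) * (snd z + 0)) by nra.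
  split; unfold Re, Im; simpl; auto_derive; unfold Re, Im; simpl.
  - repeat split; auto.
  - field. nra.
  - repeat split; auto. lra.
  - field. repeat split; nra.
Qed.

Lemma Cinv_path_derive (z : C) (tau t : R) :
  0 < Re z + t * tau ->
  path_derive (fun t => RtoC tau * / (z + RtoC (t * tau)))%C t
    (- (RtoC tau * / (z + RtoC (t * tau))) * (RtoC tau * / (z + RtoC (t * tau)))).
Proof.
  intros H. unfold Re in H.
  assert (P : 0 < (fst z + t * tau) * (fst z + t * tau) + (snd z + 0) * (snd z + 0)) by nra.
  split; unfold Re, Im; simpl; auto_derive; unfold Re, Im; simpl.
  - repeat split; auto; nra.
  - field. nra.
  - repeat split; auto; nra.
  - field. nra.
Qed.

(** The derivatives of [Clog (z + t tau)] in [t] are [tau / (z + t tau)] and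
    [- (tau / (z + t tau)) ^ 2]. *)
Lemma Clog_increment (z : C) (tau rho : R) :
  0 < rho -> 0 <= tau ->
  (forall t, Rabs t <= 1 -> rho <= Re z + t * tau) ->
  Cmod (Clog (z + RtoC tau) - Clog z) <= 2 * (tau / rho) /\
  Cmod (Clog (z + RtoC tau) - Clog z - RtoC tau * / z) <= 4 * (tau / rho) ^ 2.
Proof.
  intros Hr Htau H.
  set (f := fun t => Clog_atan (z + RtoC (t * tau))).
  set (df := fun t => (RtoC tau * / (z + RtoC (t * tau)))%C).
  assert (Hdf : forall t, Rabs t <= 1 -> Cmod (df t) <= tau / rho).
  { intros t Ht. specialize (H t Ht). unfold df.
    assert (Hz : rho <= Cmod (z + RtoC (t * tau))).
    { eapply Rle_trans; [exact H|].
      eapply Rle_trans; [|apply re_le_Cmod]. apply Rle_abs. }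
    assert (z + RtoC (t * tau) <> RtoC 0)%C by (apply Cmod_gt_0; lra).
    rewrite Cmod_mult, Cmod_R, Rabs_right, Cmod_inv by (auto; lra).
    apply Rmult_le_compat_l; auto. now apply Rinv_le_contravar. }
  assert (F1 : Clog (z + RtoC tau) = f 1).
  { unfold f. rewrite Rmult_1_l. apply Clog_atan_eq.
    specialize (H 1). rewrite Rabs_R1 in H. unfold Re in *; simpl. lra. }
  assert (F0 : Clog z = f 0).
  { unfold f. rewrite Rmult_0_l, Cplus_0_r. apply Clog_atan_eq.
    specialize (H 0). rewrite Rabs_R0 in H. lra. }
  assert (D0 : (RtoC tau * / z)%C = df 0).
  { unfold df. now rewrite Rmult_0_l, Cplus_0_r. }
  rewrite F1, F0, D0. split.
  - apply (path_taylor1 f df); [|rewrite Rabs_R1; lra].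
    intros t Ht. split; auto. apply Clog_atan_path_derive. specialize (H t Ht). lra.
  - apply (path_taylor2 f df (fun t => - df t * df t)%C).
    + intros t Ht. apply Clog_atan_path_derive. specialize (H t Ht). lra.
    + intros t Ht. split.
      * apply Cinv_path_derive. specialize (H t Ht). lra.
      * rewrite Cmod_mult, Cmod_opp. simpl. rewrite Rmult_1_r.
        apply Rmult_le_compat; auto using Cmod_ge_0.
Qed.

(** * Logarithmic sequences *)

Lemma loglike_of_eventually (d : R) (L : nat -> C) (K : R) :
  eventually (fun m =>
    Cmod (L m - RtoC (d * ln (INR m + 1))) <= K /\
    Cmod (L (S m) - L m) <= K / (INR m + 1) /\
    Cmod (diff2 L m) <= K / (INR m + 1) ^ 2) -> loglike d L.
Proof.
  intros [N HN].
  assert (Fin : forall (f : nat -> R) n, exists B, forall m, (m < n)%nat -> f m <= B).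
  { intros f n. induction n as [|n [B HB]].
    - exists 0. intros; lia.
    - exists (Rmax B (f n)). intros m Hm.
      destruct (Nat.eq_dec m n) as [->|]; [apply Rmax_r|].
      eapply Rle_trans; [apply HB; lia | apply Rmax_l]. }
  destruct (Fin (fun m => Cmod (L m - RtoC (d * ln (INR m + 1)))) N) as [B1 H1].
  destruct (Fin (fun m => Cmod (L (S m) - L m) * (INR m + 1)) N) as [B2 H2].
  destruct (Fin (fun m => Cmod (diff2 L m) * (INR m + 1) ^ 2) N) as [B3 H3].
  exists (Rmax K (Rmax B1 (Rmax B2 B3))).
  set (B := Rmax K _).
  assert (E0 : K <= B) by apply Rmax_l.
  assert (E1 : B1 <= B) by (eapply Rle_trans; [apply Rmax_l | apply Rmax_r]).
  assert (E2 : B2 <= B).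
  { eapply Rle_trans; [|apply Rmax_r]. eapply Rle_trans; [|apply Rmax_r]. apply Rmax_l. }
  assert (E3 : B3 <= B).
  { eapply Rle_trans; [|apply Rmax_r]. eapply Rle_trans; [|apply Rmax_r]. apply Rmax_r. }
  intros m. pose proof (pos_INR m) as Hm.
  assert (P2 : 0 < (INR m + 1) ^ 2) by (apply pow_lt; lra).
  assert (Dv : forall a b c, 0 < c -> a * c <= b -> a <= b / c).
  { intros a b c Hc Hab. apply Rmult_le_reg_r with c; auto. unfold Rdiv.
    rewrite Rmult_assoc, Rinv_l; lra. }
  destruct (Nat.le_gt_cases N m) as [Hge|Hlt].
  - destruct (HN m Hge) as (A1 & A2 & A3). split; [lra | split].
    + eapply Rle_trans; [exact A2|]. apply Rmult_le_compat_r; auto.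
      left; apply Rinv_0_lt_compat; lra.
    + eapply Rle_trans; [exact A3|]. apply Rmult_le_compat_r; auto.
      left; apply Rinv_0_lt_compat; lra.
  - specialize (H1 m Hlt). specialize (H2 m Hlt). specialize (H3 m Hlt).
    simpl in H1, H2. split; [lra | split]; apply Dv; lra.
Qed.

Lemma loglike_ext_loc (d : R) (L L' : nat -> C) :
  eventually (fun m => L m = L' m) -> loglike d L -> loglike d L'.
Proof.
  intros [N HN] [K HK]. apply loglike_of_eventually with K. exists N.
  intros m Hm. unfold diff2. rewrite <- !HN by lia. apply HK.
Qed.

Lemma loglike_plus (d d' : R) (L L' : nat -> C) :
  loglike d L -> loglike d' L' -> loglike (d + d') (fun m => L m + L' m)%C.
Proof.
  intros [K H] [K' H']. exists (K + K'). intros m.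
  destruct (H m) as (A1 & A2 & A3). destruct (H' m) as (B1 & B2 & B3).
  unfold Rdiv. rewrite !Rmult_plus_distr_r. repeat split.
  - replace (L m + L' m - _)%C with ((L m - RtoC (d * ln (INR m + 1))) +
      (L' m - RtoC (d' * ln (INR m + 1))))%C by (rewrite RtoC_plus; ring).
    eapply Rle_trans; [apply Cmod_triangle | now apply Rplus_le_compat].
  - replace (L (S m) + L' (S m) - _)%C with ((L (S m) - L m) + (L' (S m) - L' m))%C by ring.
    eapply Rle_trans; [apply Cmod_triangle | now apply Rplus_le_compat].
  - replace (diff2 _ m) with (diff2 L m + diff2 L' m)%C by (unfold diff2; ring).
    eapply Rle_trans; [apply Cmod_triangle | now apply Rplus_le_compat].
Qed.

Lemma loglike_csum (L : nat -> nat -> C) (n : nat) :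
  (forall j, (j < n)%nat -> loglike 1 (L j)) ->
  loglike (INR n) (fun m => csum (fun j => L j m) n).
Proof.
  induction n as [|n IH]; intros H.
  - exists 0. intros m. simpl. unfold diff2. rewrite Rmult_0_l.
    replace (RtoC 0 - RtoC 0)%C with (RtoC 0) by ring.
    replace (RtoC 0 - RtoC 2 * RtoC 0 + RtoC 0)%C with (RtoC 0) by ring.
    rewrite Cmod_0. unfold Rdiv. rewrite !Rmult_0_l. lra.
  - rewrite S_INR. cbn [csum]. apply loglike_plus; auto.
Qed.

Lemma eventually_INR_ge (B : R) : eventually (fun m => B <= INR m).
Proof.
  destruct (INR_unbounded B) as [N HN]. exists N. intros m Hm.
  apply le_INR in Hm. lra.
Qed.

(** For large [m] the segment from [m + x] to [m + x + 2] stays in the half-plane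
    [Re z >= (m + 1) / 2], which gives first and second differences of the order of
    [1 / m] and [1 / m ^ 2]. *)
Lemma loglike_Clog (x : C) : loglike 1 (fun m => Clog (RtoC (INR m) + x)).
Proof.
  apply loglike_of_eventually with 100.
  (* [m - Cmod x - 2 >= (m + 1) / 2] for these [m]. *)
  destruct (eventually_INR_ge (2 * Cmod x + 5)) as [N HN].
  exists N. intros m Hm. specialize (HN m Hm).
  set (z := (RtoC (INR m) + x)%C). set (q := INR m + 1).
  pose proof (re_le_Cmod x) as Hx. apply Rabs_le_between in Hx.
  pose proof (Cmod_ge_0 x) as Hx0. pose proof (pos_INR m) as Hm0.
  assert (Hrez : Re z = INR m + Re x) by reflexivity.
  assert (Hq : 0 < q / 2) by (unfold q; lra).
  assert (Hstep : forall tau, 0 <= tau <= 2 -> forall t, Rabs t <= 1 -> q / 2 <= Re z + t * tau).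
  { intros tau Htau t Ht. apply Rabs_le_between in Ht. rewrite Hrez.
    assert (- 2 <= t * tau) by nra. unfold q. lra. }
  destruct (Clog_increment z 1 (q / 2)) as [A1 A2]; auto; [lra | apply Hstep; lra|].
  destruct (Clog_increment z 2 (q / 2)) as [B1 B2]; auto; [lra | apply Hstep; lra|].
  assert (E1 : (RtoC (INR (S m)) + x)%C = (z + RtoC 1)%C).
  { rewrite S_INR, RtoC_plus. unfold z. ring. }
  assert (E2 : (RtoC (INR (S (S m))) + x)%C = (z + RtoC 2)%C).
  { rewrite !S_INR, !RtoC_plus. unfold z.
    replace (RtoC 2) with (RtoC 1 + RtoC 1)%C by (rewrite <- RtoC_plus; f_equal; lra).
    ring. }
  assert (Hqi : 0 < / q) by (apply Rinv_0_lt_compat; unfold q; lra).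
  unfold diff2. rewrite E1, E2. fold z. repeat split.
  - eapply Rle_trans; [apply Cmod_le_abs|].
    assert (Hz : z <> RtoC 0).
    { intros E. pose proof (Hstep 0 ltac:(lra) 0) as A. rewrite Rabs_R0, E in A.
      unfold Re in A; simpl in A. lra. }
    replace (Re (Clog z - RtoC (1 * ln q))) with (ln (Cmod z) - ln q)
      by (unfold Clog, Re; simpl; ring).
    replace (Im (Clog z - RtoC (1 * ln q))) with (Carg z)
      by (unfold Clog, Im; simpl; ring).
    assert (C1 : Rabs (Carg z) <= 4).
    { pose proof (Carg_bound z Hz). pose proof PI_4. apply Rabs_le; lra. }
    assert (L1 : q / 2 <= Cmod z).
    { pose proof (Hstep 0 ltac:(lra) 0) as A. rewrite Rabs_R0 in A.
      eapply Rle_trans; [apply A; lra|]. rewrite Rmult_0_l, Rplus_0_r.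
      eapply Rle_trans; [apply Rle_abs | apply re_le_Cmod]. }
    assert (L2 : Cmod z <= q * 2).
    { unfold z. eapply Rle_trans; [apply Cmod_triangle|].
      rewrite Cmod_R, Rabs_right by lra. unfold q. lra. }
    assert (ln (q / 2) <= ln (Cmod z)) by (apply ln_le; auto).
    assert (ln (Cmod z) <= ln (q * 2)) by (apply ln_le; lra).
    unfold Rdiv in *. rewrite ln_mult, ln_Rinv in * by lra.
    pose proof ln_lt_2.
    assert (ln 2 < 1).
    { apply exp_lt_inv. rewrite exp_ln by lra. pose proof (exp_ineq1 1). lra. }
    assert (Rabs (ln (Cmod z) - ln q) <= 1) by (apply Rabs_le; lra). lra.
  - eapply Rle_trans; [exact A1|]. unfold Rdiv. rewrite Rinv_mult, Rinv_inv. fold q. lra.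
  - replace (Clog z - RtoC 2 * Clog (z + RtoC 1) + Clog (z + RtoC 2))%C with
      ((Clog (z + RtoC 2) - Clog z - RtoC 2 * / z) +
       - RtoC 2 * (Clog (z + RtoC 1) - Clog z - RtoC 1 * / z))%C by ring.
    eapply Rle_trans; [apply Cmod_triangle|].
    rewrite Cmod_mult, Cmod_opp, Cmod_R, (Rabs_right 2) by lra. fold q.
    replace (100 / q ^ 2) with (100 * (/ q) ^ 2) by (field; unfold q; lra).
    replace (1 / (q / 2)) with (2 * / q) in A2 by (field; unfold q; lra).
    replace (2 / (q / 2)) with (4 * / q) in B2 by (field; unfold q; lra).
    nra.
Qed.

Lemma Carg_shift_lim (x : C) :
  is_lim_seq (fun m => Im (Clog (RtoC (INR m) + x))) 0.
Proof.
  apply is_lim_seq_ext_loc with (fun m => atan (Im x * / (INR m + Re x))).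
  - destruct (eventually_INR_ge (Rabs (Re x) + 1)) as [N HN].
    exists N. intros m Hm. specialize (HN m Hm).
    pose proof (Rabs_maj2 (Re x)).
    rewrite Clog_atan_eq by (unfold Re in *; simpl; lra).
    unfold Clog_atan, Re, Im; simpl. now rewrite Rplus_0_l.
  - rewrite <- atan_0. apply is_lim_seq_continuous.
    { apply derivable_continuous_pt, derivable_pt_atan. }
    replace (Finite 0) with (Rbar_mult (Im x) 0) by (simpl; f_equal; ring).
    apply is_lim_seq_scal_l. change (Finite 0) with (Rbar_inv p_infty).
    apply is_lim_seq_inv; [|discriminate].
    eapply is_lim_seq_plus; [apply is_lim_seq_INR | apply is_lim_seq_const | reflexivity].
Qed.

(** * Wallis' product and the alternating harmonic series *)

Definition sin_int (n : nat) : R := RInt (fun t => sin t ^ n) 0 (PI / 2).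

Lemma continuous_sin_pow (n : nat) (t : R) : continuous (fun t => sin t ^ n) t.
Proof.
  apply (ex_derive_continuous (fun t => sin t ^ n)). auto_derive; auto.
Qed.

Lemma ex_RInt_sin_pow (n : nat) : ex_RInt (fun t => sin t ^ n) 0 (PI / 2).
Proof. apply (ex_RInt_continuous (V := R_CompleteNormedModule)). intros; apply continuous_sin_pow. Qed.

(** Integrate the derivative of [sin ^ (n + 1) * cos], which vanishes at both
    ends. *)
Lemma sin_int_rec (n : nat) : (INR n + 2) * sin_int (S (S n)) = (INR n + 1) * sin_int n.
Proof.
  assert (H : is_RInt (fun t => (INR n + 1) * sin t ^ n - (INR n + 2) * sin t ^ (S (S n)))
     0 (PI / 2) 0).
  { replace 0 with (minus (sin (PI / 2) ^ (S n) * cos (PI / 2)) (sin 0 ^ (S n) * cos 0)) at 2.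
    2:{ rewrite cos_PI2, sin_0. unfold minus, plus, opp; simpl. ring. }
    apply (is_RInt_derive (fun t => sin t ^ (S n) * cos t)).
    - intros t _. auto_derive; auto.
      change (match n with O => 1 | S _ => INR n + 1 end) with (INR (S n)).
      rewrite S_INR.
      pose proof (sin2_cos2 t) as E. unfold Rsqr in E. simpl.
      transitivity ((INR n + 1) * sin t ^ n * (cos t * cos t) - sin t * sin t ^ n * sin t).
      + ring.
      + replace (cos t * cos t) with (1 - sin t * sin t) by lra. ring.
    - intros t _. apply (continuous_minus (V := R_NormedModule)).
      + apply (continuous_scal_r (V := R_NormedModule) (INR n + 1)), continuous_sin_pow.
      + apply (continuous_scal_r (V := R_NormedModule) (INR n + 2)), continuous_sin_pow. }
  assert (H' : is_RInt (fun t => (INR n + 1) * sin t ^ n - (INR n + 2) * sin t ^ (S (S n)))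
     0 (PI / 2) ((INR n + 1) * sin_int n - (INR n + 2) * sin_int (S (S n)))).
  { apply (is_RInt_minus (V := R_NormedModule));
      apply (is_RInt_scal (V := R_NormedModule));
      apply (RInt_correct (V := R_CompleteNormedModule)), ex_RInt_sin_pow. }
  apply (is_RInt_unique (V := R_CompleteNormedModule)) in H, H'.
  rewrite H in H'. lra.
Qed.

Lemma sin_int_0 : sin_int 0 = PI / 2.
Proof.
  unfold sin_int. rewrite (RInt_ext _ (fun _ => 1)) by (intros; reflexivity).
  rewrite RInt_const. unfold scal; simpl. unfold mult; simpl. ring.
Qed.

Lemma sin_int_1 : sin_int 1 = 1.
Proof.
  unfold sin_int. apply is_RInt_unique.
  replace 1 with (minus (- cos (PI / 2)) (- cos 0)).
  2:{ rewrite cos_PI2, cos_0. unfold minus, plus, opp; simpl. ring. }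
  apply (is_RInt_derive (fun t => - cos t)).
  - intros t _. auto_derive; auto; ring.
  - intros t _. apply continuous_sin_pow.
Qed.

Lemma sin_int_decr (n : nat) : sin_int (S n) <= sin_int n.
Proof.
  pose proof PI_RGT_0.
  apply RInt_le; try apply ex_RInt_sin_pow; [lra|].
  intros t Ht. simpl.
  assert (0 <= sin t) by (apply sin_ge_0; lra).
  pose proof (SIN_bound t). pose proof (pow_le (sin t) n). nra.
Qed.

(** The ratio of double factorials [(2 K - 1)!! / (2 K)!!]. *)
Fixpoint wallis (K : nat) : R :=
  match K with
  | O => 1
  | S k => wallis k * ((2 * INR k + 1) / (2 * INR k + 2))
  end.

Lemma wallis_pos (K : nat) : 0 < wallis K.
Proof.
  induction K as [|K IH]; simpl; [lra|]. pose proof (pos_INR K).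
  apply Rmult_lt_0_compat; auto. apply Rdiv_lt_0_compat; lra.
Qed.

Lemma INR_double (K : nat) : INR (2 * K) = 2 * INR K.
Proof. rewrite mult_INR. reflexivity. Qed.

Lemma sin_int_wallis (K : nat) :
  sin_int (2 * K) = wallis K * (PI / 2) /\
  sin_int (S (2 * K)) * (wallis K * (2 * INR K + 1)) = 1.
Proof.
  induction K as [|K [IH1 IH2]].
  - simpl. rewrite sin_int_0, sin_int_1. split; ring.
  - pose proof (pos_INR K). pose proof (wallis_pos K).
    replace (2 * S K)%nat with (S (S (2 * K))) by lia.
    pose proof (sin_int_rec (2 * K)) as R1.
    pose proof (sin_int_rec (S (2 * K))) as R2.
    rewrite S_INR in R2. rewrite INR_double in R1, R2. rewrite IH1 in R1.
    rewrite S_INR. cbn [wallis]. split.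
    + apply Rmult_eq_reg_l with (2 * INR K + 2); [|lra]. rewrite R1. field. lra.
    + eapply eq_trans; [|exact IH2].
      apply Rmult_eq_reg_l with ((2 * INR K + 2) / (2 * INR K + 1)).
      2:{ apply Rgt_not_eq, Rdiv_lt_0_compat; lra. }
      replace (_ * (sin_int (S (2 * K)) * _)) with
        (wallis K * ((2 * INR K + 1 + 1) * sin_int (S (2 * K)))) by (field; lra).
      rewrite <- R2. field. lra.
Qed.

(** The integrals [sin_int] decrease, so that
    [sin_int (2 K + 2) <= sin_int (2 K + 1) <= sin_int (2 K)]; by [sin_int_wallis] this
    squeezes the sequence around [2 / PI]. *)
Lemma wallis_lim :
  is_lim_seq (fun K => wallis K * wallis K * (2 * INR K + 1)) (2 / PI).
Proof.
  pose proof PI_RGT_0 as Hpi.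
  apply is_lim_seq_le_le with (u := fun _ => 2 / PI)
    (w := fun K => 2 / PI * (1 + / (2 * INR K + 1))).
  - intros K. pose proof (pos_INR K) as HK. pose proof (wallis_pos K) as Hw.
    destruct (sin_int_wallis K) as [E1 E2].
    destruct (sin_int_wallis (S K)) as [E3 _].
    pose proof (sin_int_decr (2 * K)) as D1.
    pose proof (sin_int_decr (S (2 * K))) as D2.
    replace (2 * S K)%nat with (S (S (2 * K))) in E3 by lia.
    rewrite E1 in D1. rewrite E3 in D2. cbn [wallis] in D2.
    set (J := sin_int (S (2 * K))) in *. set (k := INR K) in *. set (w := wallis K) in *.
    assert (Hp : 0 < w * (2 * k + 1)) by (apply Rmult_lt_0_compat; lra).
    split; apply Rmult_le_reg_r with (PI / 2); try lra.
    + replace (2 / PI * (PI / 2)) with 1 by (field; lra).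
      apply Rle_trans with (J * (w * (2 * k + 1))); [lra|].
      apply Rle_trans with (w * (PI / 2) * (w * (2 * k + 1))).
      * apply Rmult_le_compat_r; lra.
      * right; ring.
    + replace (2 / PI * (1 + / (2 * k + 1)) * (PI / 2)) with
        (1 * ((2 * k + 2) / (2 * k + 1))) by (field; lra).
      apply Rle_trans with (J * (w * (2 * k + 1)) * ((2 * k + 2) / (2 * k + 1)));
        [|rewrite E2; lra].
      replace (w * w * (2 * k + 1) * (PI / 2)) with
        (w * ((2 * k + 1) / (2 * k + 2)) * (PI / 2) * (w * (2 * k + 1)) *
          ((2 * k + 2) / (2 * k + 1))) by (field; lra).
      apply Rmult_le_compat_r.
      * left; apply Rdiv_lt_0_compat; lra.
      * apply Rmult_le_compat_r; lra.
  - apply is_lim_seq_const.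
  - replace (Finite (2 / PI)) with (Finite (2 / PI * (1 + 0))) by (f_equal; ring).
    apply is_lim_seq_mult'; [apply is_lim_seq_const|].
    apply is_lim_seq_plus'; [apply is_lim_seq_const|].
    change (Finite 0) with (Rbar_inv p_infty).
    apply is_lim_seq_inv; [|discriminate].
    eapply is_lim_seq_plus; [|apply is_lim_seq_const|].
    + apply (is_lim_seq_scal_l INR 2 p_infty), is_lim_seq_INR.
    + simpl. destruct (Rle_dec 0 2); [|lra].
      destruct (Rle_lt_or_eq_dec 0 2 r); [reflexivity | lra].
Qed.

Fixpoint alt_harmonic (N : nat) : R :=
  match N with
  | O => 0
  | S k => alt_harmonic k + (-1) ^ k / (INR k + 1)
  end.

Fixpoint harmonic (N : nat) : R :=
  match N with
  | O => 0
  | S k => harmonic k + / (INR k + 1)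
  end.

Lemma alt_harmonic_even (K : nat) :
  alt_harmonic (2 * K) = harmonic (2 * K) - harmonic K.
Proof.
  induction K as [|K IH]; [simpl; ring|].
  replace (2 * S K)%nat with (S (S (2 * K))) by lia.
  cbn [alt_harmonic harmonic]. rewrite IH, S_INR, INR_double.
  pose proof (pos_INR K).
  rewrite pow_1_odd, pow_1_even. field. lra.
Qed.

Lemma ln_le_sub1 (x : R) : 0 < x -> ln x <= x - 1.
Proof.
  intros Hx. pose proof (exp_ineq1_le (ln x)) as H. rewrite exp_ln in H by auto. lra.
Qed.

(** The limit is Euler's constant.  It cancels between [harmonic (2 * K)] and
    [harmonic K], whose difference therefore tends to [ln 2]. *)
Lemma euler_gamma_cv : ex_finite_lim_seq (fun n => harmonic (S n) - ln (INR n + 1)).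
Proof.
  apply ex_finite_lim_seq_decr with 0.
  - intros n. cbn [harmonic]. rewrite S_INR. pose proof (pos_INR n).
    pose proof (ln_le_sub1 ((INR n + 1) / (INR n + 1 + 1))) as H1.
    unfold Rdiv in H1. rewrite ln_mult, ln_Rinv in H1; try lra.
    2:{ apply Rinv_0_lt_compat; lra. }
    assert (E : (INR n + 1) * / (INR n + 1 + 1) = 1 - / (INR n + 1 + 1)) by (field; lra).
    rewrite E in H1.
    assert (A : 0 < (INR n + 1) * / (INR n + 1 + 1)).
    { apply Rmult_lt_0_compat; [lra | apply Rinv_0_lt_compat; lra]. }
    specialize (H1 ltac:(lra)). lra.
  - intros n.
    cut (ln (INR n + 2) <= harmonic (S n)).
    { pose proof (pos_INR n). assert (ln (INR n + 1) <= ln (INR n + 2)) by (apply ln_le; lra). lra. }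
    induction n as [|n IH].
    + simpl. rewrite !Rplus_0_l, Rinv_1. pose proof (ln_le_sub1 2). lra.
    + cbn [harmonic] in *. rewrite S_INR. pose proof (pos_INR n).
      pose proof (ln_le_sub1 ((INR n + 1 + 2) / (INR n + 2))) as H1.
      assert (A : 0 < (INR n + 1 + 2) / (INR n + 2)) by (apply Rdiv_lt_0_compat; lra).
      specialize (H1 A). unfold Rdiv in H1. rewrite ln_mult, ln_Rinv in H1; try lra.
      2:{ apply Rinv_0_lt_compat; lra. }
      assert (E : (INR n + 1 + 2) * / (INR n + 2) = 1 + / (INR n + 1 + 1)) by (field; lra).
      rewrite E in H1. lra.
Qed.

Lemma alt_harmonic_lim : is_lim_seq alt_harmonic (ln 2).
Proof.
  destruct euler_gamma_cv as [g Hg].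
  assert (A : Clim (fun N => RtoC (alt_harmonic N)) (RtoC (ln 2))); [|apply A].
  apply Clim_of_even_odd.
  - apply Clim_RtoC. apply is_lim_seq_incr_1.
    apply is_lim_seq_ext with (fun n =>
      (harmonic (S (2 * n + 1)) - ln (INR (2 * n + 1) + 1)) -
      (harmonic (S n) - ln (INR n + 1)) + ln 2).
    + intros n. rewrite alt_harmonic_even.
      replace (2 * S n)%nat with (S (2 * n + 1)) by lia.
      rewrite plus_INR, INR_double. simpl (INR 1).
      replace (2 * INR n + 1 + 1) with (2 * (INR n + 1)) by ring.
      pose proof (pos_INR n). rewrite ln_mult by lra. lra.
    + replace (Finite (ln 2)) with (Finite (g - g + ln 2)) by (f_equal; ring).
      apply is_lim_seq_plus'; [|apply is_lim_seq_const].
      apply is_lim_seq_minus'; auto.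
      apply (is_lim_seq_subseq (fun n => harmonic (S n) - ln (INR n + 1)) g
        (fun n => (2 * n + 1)%nat)); auto.
      intros P [N HN]. exists N. intros n Hn. apply HN. lia.
  - apply Clim_bound_0 with (fun k => / (INR k + 1)).
    + intros k. cbn [alt_harmonic]. rewrite <- RtoC_minus, Cmod_R.
      replace (alt_harmonic k + (-1) ^ k / (INR k + 1) - alt_harmonic k)
        with ((-1) ^ k * / (INR k + 1)) by (unfold Rdiv; ring).
      rewrite Rabs_mult, pow_1_abs, Rmult_1_l. pose proof (pos_INR k).
      rewrite Rabs_right; [lra|]. left; apply Rinv_0_lt_compat; lra.
    + apply inv_INR_lim.
Qed.

(** * The modified gamma function *)

Lemma Cprod_ext (f g : nat -> C) (n : nat) :
  (forall k, (k < n)%nat -> f k = g k) -> Cprod f n = Cprod g n.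
Proof. induction n as [|n IH]; intros H; simpl; auto. rewrite IH, H; auto. Qed.

Lemma Cexp_csum (f : nat -> C) (n : nat) :
  Cexp (csum f n) = Cprod (fun k => Cexp (f k)) n.
Proof.
  induction n as [|n IH]; simpl; [apply Cexp_0|]. now rewrite Cexp_plus, IH.
Qed.

Lemma Calt_Cexp (m : nat) (z : C) : Calt m (Cexp z) = Cexp (RtoC (-1) ^ m * z).
Proof.
  unfold Calt. destruct (Nat.Even_or_Odd m) as [[k ->]|[k ->]].
  - rewrite (proj2 (Nat.even_spec _)) by now exists k.
    rewrite Cpow_m1_even. f_equal. ring.
  - rewrite Nat.add_1_r, Nat.even_succ.
    replace (Nat.odd (2 * k)) with false.
    + rewrite Cpow_S, Cpow_m1_even, <- Cexp_opp. f_equal.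
      rewrite RtoC_m1.
      ring.
    + unfold Nat.odd. rewrite (proj2 (Nat.even_spec _)) by now exists k. reflexivity.
Qed.

Lemma Clog_pos (r : R) : 0 < r -> Clog (RtoC r) = RtoC (ln r).
Proof.
  intros Hr. rewrite Clog_atan_eq by (unfold Re; simpl; lra).
  unfold Clog_atan, Re, Im; simpl. apply C_ext; unfold Re, Im; simpl.
  - rewrite Rmult_0_l, Rplus_0_r, ln_mult by auto. lra.
  - unfold Rdiv. rewrite Rmult_0_l. apply atan_0.
Qed.

Lemma continuity_pt_ln (r : R) : 0 < r -> continuity_pt ln r.
Proof.
  intros Hr. apply derivable_continuous_pt. exists (/ r).
  now apply derivable_pt_lim_ln.
Qed.

Lemma Clog_shift_lim (x : C) :
  Clim (fun m => Clog (RtoC (INR m) + x) - RtoC (ln (INR m + 1)))%C (RtoC 0).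
Proof.
  split.
  2:{ eapply is_lim_seq_ext; [|apply (Carg_shift_lim x)].
      intros m. unfold Im; simpl. ring. }
  apply is_lim_seq_ext_loc with
    (fun m => ln (Cmod (RtoC 1 + (x - RtoC 1) * RtoC (/ (INR m + 1))))).
  - destruct (eventually_INR_ge (Cmod x + 1)) as [N HN].
    exists N. intros m Hm. specialize (HN m Hm). pose proof (pos_INR m).
    assert (Hz : 0 < Cmod (RtoC (INR m) + x)).
    { pose proof (Cmod_triangle (RtoC (INR m) + x) (- x)) as T.
      replace (RtoC (INR m) + x + - x)%C with (RtoC (INR m)) in T by ring.
      rewrite Cmod_R, Cmod_opp, Rabs_right in T by lra. lra. }
    replace (RtoC 1 + (x - RtoC 1) * RtoC (/ (INR m + 1)))%C with
      ((RtoC (INR m) + x) * RtoC (/ (INR m + 1)))%C.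
    2:{ assert (Hq : RtoC (INR m + 1) <> RtoC 0) by (apply RtoC_neq; lra).
        replace (RtoC (INR m)) with (RtoC (INR m + 1) - RtoC 1)%C
          by (rewrite RtoC_plus; ring).
        rewrite RtoC_inv by lra. field. exact Hq. }
    assert (Hi : 0 < / (INR m + 1)) by (apply Rinv_0_lt_compat; lra).
    rewrite Cmod_mult, Cmod_R, Rabs_right, ln_mult, ln_Rinv by lra.
    unfold Clog, Re; simpl. ring.
  - replace (Re (RtoC 0)) with (ln 1) by (rewrite ln_1; reflexivity).
    apply is_lim_seq_continuous; [apply continuity_pt_ln; lra|].
    assert (A : Clim (fun m => RtoC 1 + (x - RtoC 1) * RtoC (/ (INR m + 1)))%C
      (RtoC 1 + (x - RtoC 1) * RtoC 0)%C).
    { apply Clim_plus; [apply Clim_const|]. apply Clim_scal, Clim_RtoC, inv_INR_lim. }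
    replace (RtoC 1 + (x - RtoC 1) * RtoC 0)%C with (RtoC 1) in A by ring.
    apply Clim_Cmod in A.
    apply is_lim_seq_le_le with
      (u := fun m => 1 - Cmod (RtoC 1 + (x - RtoC 1) * RtoC (/ (INR m + 1)) - RtoC 1))
      (w := fun m => 1 + Cmod (RtoC 1 + (x - RtoC 1) * RtoC (/ (INR m + 1)) - RtoC 1)).
    + intros m. set (z := (RtoC 1 + _)%C).
      pose proof (Cmod_triangle (z - RtoC 1) (RtoC 1)) as T1.
      pose proof (Cmod_triangle z (- (z - RtoC 1))) as T2.
      replace (z - RtoC 1 + RtoC 1)%C with z in T1 by ring.
      replace (z + - (z - RtoC 1))%C with (RtoC 1) in T2 by ring.
      rewrite Cmod_opp in T2. rewrite Cmod_1 in *. lra.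
    + replace (Finite 1) with (Finite (1 - 0)) by (f_equal; ring).
      apply is_lim_seq_minus'; auto using is_lim_seq_const.
    + replace (Finite 1) with (Finite (1 + 0)) by (f_equal; ring).
      apply is_lim_seq_plus'; auto using is_lim_seq_const.
Qed.

Lemma alt_mean_Clog_cv (x : C) :
  exists l, Clim (alt_mean (fun m => Clog (RtoC (INR m) + x))) l.
Proof.
  destruct (alt_mean_log_cv 1 _ Rlt_0_1 (loglike_Clog x)) as [l Hl].
  exists l. apply alt_mean_Clim; auto.
  destruct (loglike_Clog x) as [K HK].
  apply Clim_bound_0 with (fun m => K * / (INR m + 1)).
  - intros m. destruct (HK m) as (_ & H & _).
    rewrite <- Cmod_opp.
    replace (- (Clog (RtoC (INR m) + x) - Clog (RtoC (INR (S m)) + x)))%C with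
      (Clog (RtoC (INR (S m)) + x) - Clog (RtoC (INR m) + x))%C by ring.
    exact H.
  - replace (Finite 0) with (Rbar_mult K 0) by (simpl; f_equal; ring).
    apply is_lim_seq_scal_l, inv_INR_lim.
Qed.

Lemma alt_mean_RtoC_ln (K : nat) :
  alt_mean (fun m => RtoC (ln (INR m + 1))) (2 * K) =
  RtoC (ln (wallis K * wallis K * (2 * INR K + 1)) / 2).
Proof.
  assert (E : csum (fun m => RtoC (-1) ^ m * RtoC (ln (INR m + 1)))%C (2 * K) =
    RtoC (ln (wallis K))).
  { induction K as [|K IH].
    - simpl. now rewrite ln_1.
    - replace (2 * S K)%nat with (S (S (2 * K))) by lia.
      cbn [csum wallis]. rewrite IH, Cpow_S, Cpow_m1_even, S_INR, INR_double.
      pose proof (pos_INR K). pose proof (wallis_pos K).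
      assert (0 < / (2 * INR K + 2)) by (apply Rinv_0_lt_compat; lra).
      unfold Rdiv. rewrite ln_mult, ln_mult, ln_Rinv; try lra.
      2:{ apply Rmult_lt_0_compat; lra. }
      replace (2 * INR K + 1 + 1) with (2 * INR K + 2) by ring.
      apply C_ext; unfold Re, Im; simpl; ring. }
  unfold alt_mean. rewrite E, Cpow_m1_even, INR_double.
  pose proof (wallis_pos K). pose proof (pos_INR K).
  rewrite ln_mult, ln_mult; try lra.
  2:{ apply Rmult_lt_0_compat; auto. }
  apply C_ext; unfold Re, Im; simpl; field.
Qed.

Lemma alt_mean_ln_lim :
  Clim (fun K => alt_mean (fun m => Clog (RtoC (INR m) + RtoC 1)) (2 * K))
    (RtoC (ln (2 / PI) / 2)).
Proof.
  apply Clim_ext with (fun K => RtoC (ln (wallis K * wallis K * (2 * INR K + 1)) / 2)).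
  - intros K. rewrite <- alt_mean_RtoC_ln. apply alt_mean_ext. intros m.
    rewrite <- RtoC_plus, Clog_pos; auto. pose proof (pos_INR m); lra.
  - apply Clim_RtoC. pose proof PI_RGT_0.
    apply is_lim_seq_mult'; [|apply is_lim_seq_const].
    apply is_lim_seq_continuous; [|apply wallis_lim].
    apply continuity_pt_ln. apply Rdiv_lt_0_compat; lra.
Qed.

Lemma csum_alt_mean (g : nat -> C) (M : nat) :
  csum (fun m => RtoC (-1) ^ m * g m)%C M =
  (alt_mean g M - RtoC (-1) ^ M * g M / RtoC 2)%C.
Proof. unfold alt_mean. ring. Qed.

Lemma alt_mean_shift (g : nat -> C) (M : nat) :
  alt_mean g (S M) = (g O - alt_mean (fun m => g (S m)) M)%C.
Proof.
  unfold alt_mean.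
  assert (E : csum (fun m => RtoC (-1) ^ m * g m)%C (S M) =
    (g O - csum (fun m => RtoC (-1) ^ m * g (S m))%C M)%C).
  { induction M as [|M IH]; [simpl; ring|].
    cbn [csum] in *. rewrite IH, Cpow_S.
    rewrite RtoC_m1.
    ring. }
  rewrite E, Cpow_S.
  rewrite RtoC_m1.
  field.
Qed.

Lemma csum_alt_harmonic (x : C) (N : nat) :
  csum (fun k => RtoC (-1) ^ k * (- x / RtoC (INR (S k))))%C N =
  (- x * RtoC (alt_harmonic N))%C.
Proof.
  induction N as [|N IH]; cbn [csum alt_harmonic]; [ring|].
  pose proof (pos_INR N).
  rewrite IH, S_INR, (RtoC_plus (alt_harmonic N)), RtoC_div, RtoC_pow by lra. field.
  apply RtoC_neq. lra.
Qed.

Lemma Cprod_infinite_eq (u : nat -> C) (l : C) :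
  Clim (Cprod u) l -> Cprod_infinite u = l.
Proof.
  intros H. apply Clim_filterlim in H.
  exact (iota_filterlim_locally (V := C_CompleteNormedModule) (Cprod u) l H).
Qed.

(** The [k]-th factor of the modified gamma function, before the alternating sign,
    is the exponential of [- x / (k + 1) + Clog (k + 1 + x) - Clog (k + 1)].  Alternating
    sums of the two logarithms are means up to half of the last term, and the
    difference of these last terms tends to [0]; hence the product converges to
    [exp (- x ln 2 + lx - l1)], with [lx] and [l1] the limits of the means for [x + 1] and
    [1].  The means for [x] and [x + 1] add up to [Clog x] ([alt_mean_shift]). *)
Lemma mod_Gamma_value (x : C) :
  (forall k : nat, x <> RtoC (- INR k)) ->
  exists l, Clim (fun K => alt_mean (fun m => Clog (RtoC (INR m) + x)) (2 * K)) l /\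
    (Cexp l * mod_Gamma x)%C = RtoC (sqrt (PI / 2)).
Proof.
  intros Hx.
  pose proof PI_RGT_0 as Hpi.
  assert (Hnz : forall k, (RtoC (INR k) + x)%C <> RtoC 0).
  { intros k E. apply (Hx k). rewrite RtoC_opp.
    replace x with (RtoC (INR k) + x - RtoC (INR k))%C by ring. rewrite E. ring. }
  set (L1 := fun m => Clog (RtoC (INR m) + RtoC 1)).
  set (Lx := fun m => Clog (RtoC (INR m) + (x + RtoC 1))).
  destruct (alt_mean_Clog_cv (RtoC 1)) as [l1 H1]. fold L1 in H1.
  destruct (alt_mean_Clog_cv (x + RtoC 1)) as [lx Hlx]. fold Lx in Hlx.
  assert (El1 : l1 = RtoC (ln (2 / PI) / 2)).
  { apply (Clim_unique (fun K => alt_mean L1 (2 * K))).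
    - apply (Clim_subseq (alt_mean L1) l1 (fun K => (2 * K)%nat)); auto. intros; lia.
    - apply alt_mean_ln_lim. }
  exists (Clog x - lx)%C. split.
  { assert (A : Clim (alt_mean (fun m => Clog (RtoC (INR m) + x))) (Clog x - lx)).
    { apply Clim_S. apply Clim_ext with (fun M => Clog x - alt_mean Lx M)%C.
      - intros M. rewrite alt_mean_shift. simpl (INR 0). rewrite Cplus_0_l.
        rewrite (alt_mean_ext (fun m => Clog (RtoC (INR (S m)) + x)) Lx); auto.
        intros m. unfold Lx. f_equal. rewrite S_INR, RtoC_plus. ring.
      - apply Clim_minus; auto using Clim_const. }
    apply (Clim_subseq _ _ (fun K => (2 * K)%nat)) in A; auto. intros; lia. }
  assert (HP : Clim (Cprod (fun k : nat =>
     let m := S k in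
     Calt (S m) (Cexp (- x / RtoC (INR m)) * (1 + x / RtoC (INR m))))%C)
     (Cexp (- x * RtoC (ln 2) + (lx - l1)))).
  { apply Clim_ext with (fun N => Cexp (- x * RtoC (alt_harmonic N) +
      ((alt_mean Lx N - alt_mean L1 N) -
       RtoC (-1) ^ N / RtoC 2 * (Lx N - L1 N)))).
    - intros N.
      replace (- x * RtoC (alt_harmonic N) +
        ((alt_mean Lx N - alt_mean L1 N) - RtoC (-1) ^ N / RtoC 2 * (Lx N - L1 N)))%C
      with (csum (fun k => RtoC (-1) ^ k * (- x / RtoC (INR (S k)) + (Lx k - L1 k)))%C N).
      + rewrite Cexp_csum. apply Cprod_ext. intros k _. cbv zeta.
        change (Calt (S (S k))) with (Calt k). rewrite <- Calt_Cexp. f_equal.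
        rewrite Cexp_plus. f_equal. unfold Cminus. rewrite Cexp_plus, Cexp_opp.
        assert (Hk : RtoC (INR k + 1) <> RtoC 0).
        { apply RtoC_neq. pose proof (pos_INR k). lra. }
        unfold Lx, L1.
        replace (RtoC (INR k) + (x + RtoC 1))%C with (RtoC (INR (S k)) + x)%C
          by (rewrite S_INR, RtoC_plus; ring).
        rewrite <- RtoC_plus, !Cexp_Clog; auto.
        rewrite S_INR. field. exact Hk.
      + rewrite (csum_ext _ (fun k => RtoC (-1) ^ k * (- x / RtoC (INR (S k))) +
          (RtoC (-1) ^ k * Lx k + -(1) * (RtoC (-1) ^ k * L1 k)))%C) by (intros; ring).
        rewrite !csum_plus, csum_scal, csum_alt_harmonic, !csum_alt_mean. field.
    - apply Clim_Cexp. apply Clim_plus.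
      { apply Clim_scal, Clim_RtoC, alt_harmonic_lim. }
      replace (lx - l1)%C with (lx - l1 - RtoC 0)%C by ring.
      apply Clim_minus; [now apply Clim_minus|].
      pose proof (Clog_shift_lim (x + RtoC 1)) as A. apply Clim_Cmod in A.
      refine (Clim_bound_0 _ _ _ A). intros N.
      rewrite Cmod_mult, Cmod_div, Cmod_pow_m1, Cmod_R, Rabs_right;
        [|lra | apply RtoC_neq; lra].
      unfold L1. rewrite <- RtoC_plus, Clog_pos by (pose proof (pos_INR N); lra).
      fold (Lx N).
      replace (Lx N - RtoC (ln (INR N + 1)) - RtoC 0)%C with
        (Lx N - RtoC (ln (INR N + 1)))%C by ring.
      pose proof (Cmod_ge_0 (Lx N - RtoC (ln (INR N + 1)))). lra. }
  apply Cprod_infinite_eq in HP. cbv zeta in HP.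
  unfold mod_Gamma. cbv zeta. rewrite HP.
  unfold Cminus at 1. rewrite Cexp_plus, Cexp_Clog.
  2:{ specialize (Hnz O). simpl in Hnz. now rewrite Cplus_0_l in Hnz. }
  replace (x * Cexp (- lx) * (/ x * Cexp (x * RtoC (ln 2)) *
    Cexp (- x * RtoC (ln 2) + (lx - l1))))%C with
    (Cexp (- lx) * (Cexp (x * RtoC (ln 2)) * Cexp (- x * RtoC (ln 2) + (lx - l1))))%C.
  2:{ field. specialize (Hnz O). simpl in Hnz. now rewrite Cplus_0_l in Hnz. }
  rewrite <- !Cexp_plus.
  replace (- lx + (x * RtoC (ln 2) + (- x * RtoC (ln 2) + (lx - l1))))%C
    with (- l1)%C by ring.
  rewrite El1, <- RtoC_opp, Cexp_RtoC. f_equal.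
  rewrite <- exp_half_ln by lra. f_equal.
  unfold Rdiv. rewrite !ln_mult, !ln_Rinv; try lra; apply Rinv_0_lt_compat; lra.
Qed.

(** * Roots of [z ^ n = -1] *)

(** Monic polynomial functions of degree [n], in Horner form. *)
Fixpoint monic (n : nat) (f : C -> C) : Prop :=
  match n with
  | O => forall z, f z = RtoC 1
  | S k => exists (g : C -> C) (c : C), monic k g /\ forall z, f z = (z * g z + c)%C
  end.

Lemma monic_divide (n : nat) (f : C -> C) (a : C) :
  monic (S n) f ->
  exists g, monic n g /\ forall z, f z = ((z - a) * g z + f a)%C.
Proof.
  revert f. induction n as [|n IH]; intros f (g & c & Hg & Hf).
  - exists g. split; auto. intros z. rewrite !Hf. simpl in Hg. rewrite !Hg. ring.
  - destruct (IH g Hg) as (q & Hq & E).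
    exists (fun z => z * q z + g a)%C. split.
    + exists q, (g a). auto.
    + intros z. rewrite !Hf, (E z). ring.
Qed.

(** Splitting off the last root leaves a monic polynomial that still vanishes at the
    others, since they are different from it. *)
Lemma monic_roots (n : nat) (f : C -> C) (r : nat -> C) :
  monic n f -> (forall j, (j < n)%nat -> f (r j) = RtoC 0) ->
  (forall i j, (i < j < n)%nat -> r i <> r j) ->
  forall z, f z = Cprod (fun j => z - r j)%C n.
Proof.
  revert f. induction n as [|n IH]; intros f Hm Hr Hd z; [apply Hm|].
  destruct (monic_divide n f (r n) Hm) as (g & Hg & E).
  rewrite (Hr n) in E by lia. simpl. rewrite <- (IH g); auto.
  - rewrite E. ring.
  - intros j Hj. assert (A : ((r j - r n) * g (r j))%C = RtoC 0).
    { rewrite <- (Hr j) at 1 by lia. rewrite (E (r j)). ring. }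
    destruct (Ceq_dec (g (r j)) (RtoC 0)) as [|Hn]; auto. exfalso.
    apply (Hd j n); [lia|].
    assert (B : (r j - r n)%C <> RtoC 0 -> False).
    { intros B. exact (Cmult_neq_0 _ _ B Hn A). }
    destruct (Ceq_dec (r j - r n)%C (RtoC 0)) as [B'|B']; [|now destruct (B B')].
    replace (r j) with ((r j - r n) + r n)%C by ring. rewrite B'. ring.
  - intros i j Hij. apply Hd. lia.
Qed.

Lemma monic_pow_add (n : nat) (c : C) : (0 < n)%nat -> monic n (fun z => z ^ n + c)%C.
Proof.
  intros Hn. destruct n as [|n]; [lia|]. exists (fun z => z ^ n)%C, c. split; auto.
  clear. induction n as [|n IH]; [intros z; reflexivity|].
  exists (fun z => z ^ n)%C, (RtoC 0). split; auto. intros z. rewrite Cpow_S. ring.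
Qed.

Lemma Cexp_pow (z : C) (n : nat) : (Cexp z ^ n)%C = Cexp (RtoC (INR n) * z).
Proof.
  induction n as [|n IH].
  - simpl. rewrite Cmult_0_l. now rewrite Cexp_0.
  - rewrite Cpow_S, IH, <- Cexp_plus, S_INR, RtoC_plus. f_equal. ring.
Qed.

Lemma zeta_root_pow (n j : nat) : (0 < n)%nat -> (zeta_root n j ^ n)%C = RtoC (-1).
Proof.
  intros Hn. unfold zeta_root. rewrite Cexp_pow.
  assert (0 < INR n) by now apply lt_0_INR.
  replace (RtoC (INR n) * (RtoC ((2 * INR j + 1) * PI / INR n) * Ci))%C with
    (RtoC ((2 * INR j + 1) * PI) * Ci)%C.
  2:{ rewrite Cmult_assoc, <- RtoC_mult. f_equal. f_equal. field. lra. }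
  unfold Cexp. apply C_ext; unfold Re, Im; simpl.
  - replace ((2 * INR j + 1) * PI * 0 - 0 * 1) with 0 by ring.
    replace ((2 * INR j + 1) * PI * 1 + 0 * 0) with (PI + 2 * INR j * PI) by ring.
    rewrite exp_0, cos_period, cos_PI. ring.
  - replace ((2 * INR j + 1) * PI * 0 - 0 * 1) with 0 by ring.
    replace ((2 * INR j + 1) * PI * 1 + 0 * 0) with (PI + 2 * INR j * PI) by ring.
    rewrite exp_0, sin_period, sin_PI. ring.
Qed.

Lemma zeta_root_inj (n i j : nat) : (i < j < n)%nat -> zeta_root n i <> zeta_root n j.
Proof.
  intros [Hij Hj] E.
  assert (Hn : 0 < INR n) by (apply lt_0_INR; lia).
  apply lt_INR in Hij, Hj. pose proof (pos_INR i). pose proof PI_RGT_0.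
  assert (EI : forall k, Im (RtoC ((2 * INR k + 1) * PI / INR n) * Ci) =
    (2 * INR k + 1) * PI / INR n) by (intros; unfold Im; simpl; ring).
  assert (D : (2 * INR j + 1) * PI / INR n - (2 * INR i + 1) * PI / INR n =
     2 * PI * ((INR j - INR i) / INR n)) by (field; lra).
  assert (B : 0 < (INR j - INR i) / INR n) by (apply Rdiv_lt_0_compat; lra).
  assert (B' : (INR j - INR i) / INR n < 1).
  { apply Rmult_lt_reg_r with (INR n); auto. unfold Rdiv.
    rewrite Rmult_assoc, Rinv_l; lra. }
  apply Cexp_inj_strip in E.
  - apply (f_equal Im) in E. rewrite !EI in E. nra.
  - rewrite !EI. apply Rabs_def1; nra.
Qed.

(** For [y <> 0] the numbers [- zeta_j y] are [n] distinct roots of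
    [z ^ n + y ^ n]; evenness of [n] makes [(- zeta_j y) ^ n = zeta_j ^ n y ^ n]. *)
Lemma pow_add_factor (n : nat) (X y : C) : Nat.Even n -> (0 < n)%nat ->
  (X ^ n + y ^ n)%C = Cprod (fun j => X + zeta_root n j * y)%C n.
Proof.
  intros He Hn. destruct (Ceq_dec y (RtoC 0)) as [->|Hy].
  - rewrite (Cprod_ext _ (fun _ => X)) by (intros; ring).
    assert (E : forall k, (X ^ k)%C = Cprod (fun _ => X) k).
    { induction k as [|k IH]; simpl; auto. rewrite <- IH. ring. }
    rewrite <- E. destruct n as [|n]; [lia|]. rewrite (Cpow_S (RtoC 0)). ring.
  - rewrite (monic_roots n (fun z => z ^ n + y ^ n)%C (fun j => - zeta_root n j * y)%C).
    + apply Cprod_ext. intros j _. ring.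
    + now apply monic_pow_add.
    + intros j _. rewrite Cpow_mult_l.
      replace (- zeta_root n j)%C with (RtoC (-1) * zeta_root n j)%C
        by (apply C_ext; unfold Re, Im; simpl; ring).
      rewrite Cpow_mult_l, zeta_root_pow by auto.
      destruct He as [k Hk]. rewrite Hk at 1. rewrite Cpow_m1_even.
      apply C_ext; unfold Re, Im; simpl; ring.
    + intros i j Hij E. apply (zeta_root_inj n i j Hij).
      replace (zeta_root n i) with (- (- zeta_root n i * y) * / y)%C by (field; auto).
      rewrite E. field; auto.
Qed.

(** * The two regularized products *)

Lemma Clim_csum (u : nat -> nat -> C) (l : nat -> C) (n : nat) :
  (forall j, (j < n)%nat -> Clim (fun K => u j K) (l j)) ->
  Clim (fun K => csum (fun j => u j K) n) (csum l n).
Proof.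
  induction n as [|n IH]; intros H; simpl; [apply Clim_const|].
  apply Clim_plus; auto.
Qed.

(** Additivity of the means: the reason why regularization is multiplicative over
    the [n] factors. *)
Lemma alt_mean_csum (L : nat -> nat -> C) (n M : nat) :
  alt_mean (fun m => csum (fun j => L j m) n) M = csum (fun j => alt_mean (L j) M) n.
Proof.
  induction n as [|n IH]; cbn [csum].
  - unfold alt_mean. rewrite (csum_ext _ (fun m => RtoC 0 * RtoC 0)%C) by (intros; ring).
    rewrite csum_scal. field.
  - now rewrite alt_mean_plus, IH.
Qed.

Lemma Cprod_neq_0 (f : nat -> C) (n : nat) :
  (forall j, (j < n)%nat -> f j <> RtoC 0) -> Cprod f n <> RtoC 0.
Proof.
  induction n as [|n IH]; intros H; simpl.
  - apply RtoC_neq; lra.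
  - apply Cmult_neq_0; auto.
Qed.

(** Changing the branch of the logarithms alters the sum in [alt_mean] by multiples
    of [2 PI i], but its last, halved term only by a multiple of [PI i]: hence the
    hypothesis at [M]. *)
Lemma Cexp_alt_mean_eq (L G : nat -> C) (M : nat) :
  (forall m, Cexp (L m) = Cexp (G m)) -> L M = G M ->
  Cexp (alt_mean L M) = Cexp (alt_mean G M).
Proof.
  intros H HM. unfold alt_mean. rewrite HM, !Cexp_plus. f_equal.
  rewrite !Cexp_csum. apply Cprod_ext. intros k _.
  now rewrite <- !Calt_Cexp, H.
Qed.

(** The exponential of the limit of the means depends on the numbers whose logarithms
    are taken, not on the branches chosen for finitely many of them; this covers both
    readings of the complex powers at once. *)
Lemma alt_zeta_value_of_logs (n : nat) (t L : nat -> C) (pw : nat -> C -> C) :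
  (0 < n)%nat ->
  (forall j k, (j < n)%nat -> t j <> RtoC (- INR k)) ->
  (forall m, Cexp (L m) = Cprod (fun j => RtoC (INR m) + t j)%C n) ->
  eventually (fun m => L m = csum (fun j => Clog (RtoC (INR m) + t j)) n) ->
  (forall m s, pw m s = Cexp (- s * L m)) ->
  is_alt_zeta_value pw (RtoC (sqrt (PI / 2)) ^ n / Cprod (fun j => mod_Gamma (t j)) n)%C.
Proof.
  intros Hn Ht HL Hev Hpw.
  assert (Hnz : forall m j, (j < n)%nat -> (RtoC (INR m) + t j)%C <> RtoC 0).
  { intros m j Hj E. apply (Ht j m Hj). rewrite RtoC_opp.
    replace (t j) with (RtoC (INR m) + t j - RtoC (INR m))%C by ring. rewrite E. ring. }
  set (G := fun m => csum (fun j => Clog (RtoC (INR m) + t j)) n) in *.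
  assert (HG : forall m, Cexp (G m) = Cprod (fun j => RtoC (INR m) + t j)%C n).
  { intros m. unfold G. rewrite Cexp_csum. apply Cprod_ext.
    intros j Hj. apply Cexp_Clog. now apply Hnz. }
  assert (HlG : loglike (INR n) G).
  { apply (loglike_csum (fun j m => Clog (RtoC (INR m) + t j))).
    intros; apply loglike_Clog. }
  assert (HlL : loglike (INR n) L).
  { apply loglike_ext_loc with G; auto.
    destruct Hev as [N HN]. exists N. intros; symmetry; auto. }
  assert (Hn' : 0 < INR n) by now apply lt_0_INR.
  destruct (alt_mean_log_cv (INR n) L Hn' HlL) as [l Hl].
  (* A limit for each [j]; [Clim_seq] selects all of them at once. *)
  assert (Hlj : exists lj : nat -> C, forall j, (j < n)%nat ->
    Clim (fun K => alt_mean (fun m => Clog (RtoC (INR m) + t j)) (2 * K)) (lj j) /\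
    (Cexp (lj j) * mod_Gamma (t j))%C = RtoC (sqrt (PI / 2))).
  { clear - Ht. exists (fun j =>
      Clim_seq (fun K => alt_mean (fun m => Clog (RtoC (INR m) + t j)) (2 * K))).
    intros j Hj. destruct (mod_Gamma_value (t j)) as (a & Ha & Ea); auto.
    rewrite (Clim_seq_eq _ _ Ha). auto. }
  destruct Hlj as [lj Hlj].
  assert (El : Cexp l = Cexp (csum lj n)).
  { apply (Clim_unique (fun K => Cexp (alt_mean L (2 * K)))); [now apply Clim_Cexp|].
    apply Clim_ext_loc with (fun K => Cexp (csum (fun j =>
      alt_mean (fun m => Clog (RtoC (INR m) + t j)) (2 * K)) n)).
    - destruct Hev as [N HN]. exists N. intros K HK.
      rewrite <- (alt_mean_csum (fun j m => Clog (RtoC (INR m) + t j))).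
      symmetry. apply Cexp_alt_mean_eq.
      + intros m. rewrite HL. symmetry. apply HG.
      + apply HN. lia.
    - apply Clim_Cexp, Clim_csum. intros j Hj. now apply Hlj. }
  replace (RtoC (sqrt (PI / 2)) ^ n / Cprod (fun j => mod_Gamma (t j)) n)%C with (Cexp l).
  - now apply loglike_zeta_value with (INR n) L.
  - assert (Hs : RtoC (sqrt (PI / 2)) <> RtoC 0).
    { apply RtoC_neq. pose proof PI_RGT_0. apply Rgt_not_eq, sqrt_lt_R0. lra. }
    assert (HGam : Cprod (fun j => mod_Gamma (t j)) n <> RtoC 0).
    { apply Cprod_neq_0. intros j Hj E. destruct (Hlj j Hj) as [_ A].
      rewrite E, Cmult_0_r in A. now apply Hs. }
    assert (A : (Cexp l * Cprod (fun j => mod_Gamma (t j)) n)%C =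
      (RtoC (sqrt (PI / 2)) ^ n)%C).
    { rewrite El, Cexp_csum. clear - Hlj. induction n as [|n IH]; simpl; [ring|].
      destruct (Hlj n) as [_ B]; [lia|]. rewrite <- IH, <- B by auto. ring. }
    rewrite <- A. field. exact HGam.
Qed.

(** Principal logarithms add up once the sum of the arguments lies in
    [(- PI, PI)]. *)
Lemma Clog_Cprod_eventually (n : nat) (t a : nat -> C) :
  (forall m, a m <> RtoC 0) ->
  (forall m j, (j < n)%nat -> (RtoC (INR m) + t j)%C <> RtoC 0) ->
  (forall m, a m = Cprod (fun j => RtoC (INR m) + t j)%C n) ->
  eventually (fun m => Clog (a m) = csum (fun j => Clog (RtoC (INR m) + t j)) n).
Proof.
  intros Ha Hnz Ea.
  assert (HI : is_lim_seq
    (fun m => Im (csum (fun j => Clog (RtoC (INR m) + t j)) n)) 0).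
  { clear. induction n as [|n IH]; cbn [csum].
    - apply is_lim_seq_const.
    - apply is_lim_seq_ext with (fun m =>
        Im (csum (fun j => Clog (RtoC (INR m) + t j)) n) + Im (Clog (RtoC (INR m) + t n)));
        [reflexivity|].
      replace (Finite 0) with (Finite (0 + 0)) by (f_equal; ring).
      apply is_lim_seq_plus'; auto using Carg_shift_lim. }
  apply is_lim_seq_spec in HI.
  destruct (HI (mkposreal _ PI_RGT_0)) as [N HN]. exists N. intros m Hm.
  specialize (HN m Hm). simpl in HN. rewrite Rminus_0_r in HN.
  apply Cexp_inj_strip.
  - rewrite Cexp_Clog, Cexp_csum, Ea by auto. apply Cprod_ext.
    intros j Hj. rewrite Cexp_Clog; auto.
  - change (Im (Clog (a m))) with (Carg (a m)).
    pose proof (Carg_bound (a m) (Ha m)). apply Rabs_def2 in HN.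
    apply Rabs_def1; lra.
Qed.

Theorem corollary3p25 (n : nat) (hn : Nat.Even n) (hpos : (0 < n)%nat)
    (x y : C)
    (hxy : forall j k : nat, (j < n)%nat ->
             (x + zeta_root n j * y)%C <> RtoC (- INR k)) :
  let P : C :=
    (RtoC (sqrt (PI / 2)) ^ n /
     Cprod (fun j => mod_Gamma (x + zeta_root n j * y)) n)%C in
  is_alt_zeta_prod (fun m => ((RtoC (INR m) + x) ^ n + y ^ n)%C) P /\
  is_alt_zeta_prod_factored n
    (fun m j => (RtoC (INR m) + x + zeta_root n j * y)%C) P.
Proof.
  intros P.
  set (t := fun j => (x + zeta_root n j * y)%C) in *.
  assert (Hfac : forall m j, (RtoC (INR m) + x + zeta_root n j * y)%C =
     (RtoC (INR m) + t j)%C) by (intros; unfold t; ring).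
  assert (Hnz : forall m j, (j < n)%nat -> (RtoC (INR m) + t j)%C <> RtoC 0).
  { intros m j Hj E. apply (hxy j m Hj). rewrite RtoC_opp.
    change (x + zeta_root n j * y)%C with (t j).
    replace (t j) with (RtoC (INR m) + t j - RtoC (INR m))%C by ring. rewrite E. ring. }
  assert (Ea : forall m, ((RtoC (INR m) + x) ^ n + y ^ n)%C =
     Cprod (fun j => RtoC (INR m) + t j)%C n).
  { intros m. rewrite pow_add_factor by auto. apply Cprod_ext. auto. }
  assert (Ha : forall m, ((RtoC (INR m) + x) ^ n + y ^ n)%C <> RtoC 0).
  { intros m. rewrite Ea. apply Cprod_neq_0. auto. }
  split; split.
  - exact Ha.
  - apply (alt_zeta_value_of_logs n t
      (fun m => Clog ((RtoC (INR m) + x) ^ n + y ^ n))); auto.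
    + intros m. rewrite Cexp_Clog; auto.
    + now apply Clog_Cprod_eventually.
  - intros m j Hj. rewrite Hfac. auto.
  - apply (alt_zeta_value_of_logs n t
      (fun m => csum (fun j => Clog (RtoC (INR m) + t j)) n)); auto.
    + intros m. rewrite Cexp_csum. apply Cprod_ext. intros j Hj.
      apply Cexp_Clog. auto.
    + exists 0%nat. reflexivity.
    + intros m s. rewrite <- csum_scal, Cexp_csum. apply Cprod_ext.
      intros j Hj. unfold Cpower. now rewrite Hfac.
Qed.
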